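(* Fix an integer $m\ge 1$. For each $n$, consider a uniformly shuffled deck of $mn$ cards with $n$ distinct types of cards, each type appearing exactly $m$ times. Let $S_n$ be the total number of correct guesses in the complete feedback game played on this deck with the greedy (optimal) strategy. Then: (i) The mean $\mu_n:=\mathbb{E}[S_n]$ and the variance $\sigma_n^2:=\mathrm{Var}(S_n)$ satisfy $$\mu_n\sim\sigma_n^2\sim\left(1+\frac12+\cdots+\frac1m\right)\ln n\qquad\text{as } n\to+\infty.$$ (ii) There exists a constant $C=C(m)$ depending only on $m$ such that, for all $n\ge 3$, $$\sup_{x\in\mathbb{R}}\left|\mathbb{P}\left(\frac{S_n-\mu_n}{\sigma_n}\le x\right)-\Phi(x)\right|\le C\,\frac{\ln\ln n}{\sqrt{\ln n}},$$ where $\Phi$ is the cumulative distribution function of a standard normal random variable.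
   Context: Complete feedback game: the deck is shuffled so that all arrangements are equally likely. The player knows the composition of the deck (how many cards of each type). At each step the player guesses the type of the top card of the deck; then the top card is revealed to the player and removed. The game continues until the deck is exhausted. The score is the total number of correct guesses. Greedy (optimal) strategy: at each step the player guesses a type having the maximum multiplicity among the cards remaining in the deck (ties may be broken arbitrarily; the law of the score does not depend on how they are broken). $a_n\sim b_n$ means $a_n/b_n\to1$; $\ln$ is the natural logarithm. *)

(* Defs.v *)
From HB Require Import structures.
From mathcomp Require Import all_boot all_order all_algebra finmap.
From mathcomp Require Import all_classical all_reals all_analysis.
Set Implicit Arguments.
Unset Strict Implicit.
Unset Printing Implicit Defensive.
Import Order.TTheory GRing.Theory Num.Theory.
Import numFieldNormedType.Exports.

Local Open Scope classical_set_scope.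
Local Open Scope ring_scope.

Section Deck.
Variables m n : nat.

(* Position 0 is the top of the deck; cards of the same type are
   indistinguishable. *)
Record deck := Deck {
  cards :> (m * n).-tuple 'I_n;
  deckP : [forall k : 'I_n, count_mem k cards == m] }.

HB.instance Definition _ := [isSub for cards].
HB.instance Definition _ := [Finite of deck by <:].

Let sorted_seq : seq 'I_n := flatten [seq nseq m k | k <- enum 'I_n].

Let size_sorted_seq : size sorted_seq == (m * n)%N.
Proof.
rewrite size_flatten /shape -map_comp sumnE big_map big_enum /=.
under eq_bigr do rewrite size_nseq.
by rewrite sum_nat_const card_ord mulnC.
Qed.

Let sorted_seqP : [forall k : 'I_n, count_mem k (Tuple size_sorted_seq) == m].
Proof.
apply/forallP => k /=.
rewrite count_flatten -map_comp sumnE big_map big_enum /=.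
rewrite (bigD1 k) //= count_nseq /= eqxx mul1n big1 ?addn0 // => j jk.
by rewrite count_nseq /= (negbTE jk).
Qed.

Definition sorted_deck : deck := Deck sorted_seqP.

HB.instance Definition _ := isPointed.Build deck sorted_deck.
HB.instance Definition _ := @isMeasurable.Build default_measure_display deck
  discrete_measurable discrete_measurable0
  discrete_measurableC discrete_measurableU.

End Deck.

Section Shuffle.
Variables (R : realType) (m n : nat).

Definition shuffle : set (deck m n) -> \bar R :=
  mscale ((#|{: deck m n}|%:R)^-1)%:nng (@counting (deck m n) R).

HB.instance Definition _ := Measure.on shuffle.

Let shuffle_setT : shuffle [set: deck m n] = 1%E.
Proof.
rewrite /shuffle /mscale /= /counting asboolT; last exact: finite_finset.
rewrite -EFinM; congr (_%:E).
have -> : #|` fset_set [set: deck m n]| = #|{: deck m n}|.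
  rewrite cardfE -(card_imset _ val_inj); apply: eq_card => w.
  rewrite [RHS]inE; apply/imsetP.
  have wT : w \in fset_set [set: deck m n].
    by rewrite in_fset_set ?in_setT //; exact: finite_finset.
  by exists [` wT]%fset.
rewrite mulVf // pnatr_eq0 -lt0n; apply/card_gt0P.
by exists (sorted_deck m n).
Qed.

HB.instance Definition _ :=
  @Measure_isProbability.Build _ _ R shuffle shuffle_setT.

End Shuffle.

Arguments shuffle : clear implicits.

(* The guess made at step i, as a function of the sequence of cards revealed
   so far.  The step is an explicit argument so that the type is inhabited when
   n = 0 (there are then no steps, and no type to guess). *)
Definition strategy (m n : nat) := 'I_(m * n) -> seq 'I_n -> 'I_n.

Definition greedy m n (g : strategy m n) : Prop :=
  forall (w : deck m n) (i : 'I_(m * n)) (k : 'I_n),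
    (count_mem k (drop i w) <= count_mem (g i (take i w)) (drop i w))%N.

Definition score m n (g : strategy m n) (w : deck m n) : nat :=
  #|[set i : 'I_(m * n) | g i (take i w) == tnth w i]|.

Section Law.
Variables (R : realType) (m n : nat) (g : strategy m n).

Definition scoreR (w : deck m n) : R := (score g w)%:R.

Definition mean_score : R := fine ('E_(shuffle R m n)[scoreR])%E.

Definition var_score : R := fine ('V_(shuffle R m n)[scoreR])%E.

Definition std_score : R := Num.sqrt var_score.

Definition std_score_cdf (x : R) : \bar R :=
  shuffle R m n [set w | (scoreR w - mean_score) / std_score <= x].

End Law.

Definition std_normal_cdf (R : realType) (x : R) : \bar R :=
  normal_prob 0 1 `]-oo, x].

Definition asymp_equiv (R : realType) (a b : nat -> R) : Prop :=
  a n / b n @[n --> \oo] --> (1 : R).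

(* Main.v *)
Require Import Defs.
From HB Require Import structures.
From mathcomp Require Import all_boot all_order all_algebra.
From mathcomp Require Import all_classical all_reals all_analysis.
From mathcomp Require Import fingroup perm ring lra zify.
Set Implicit Arguments.
Unset Strict Implicit.
Unset Printing Implicit Defensive.
Import Order.TTheory GRing.Theory Num.Theory.
Import numFieldNormedType.Exports.
Local Open Scope classical_set_scope.
Local Open Scope ring_scope.

(* When j cards remain, the greedy guess is correct with conditional
   probability L/j, L being the largest multiplicity among the remaining cards.
   The expected number of r-subsets of the remaining cards of a common type is
   of order j^r / n^(r-1), so by the first and second moment methods L is close
   to the number of r <= m with n^(1-1/r) <= j, the error being negligible away
   from these thresholds on a logarithmic scale.  The score is then compared
   with a sum of independent Bernoulli variables by trading the hits one at a
   time (Lindeberg); each trade costs at most the error in the conditional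
   probability times the maximal point probability of the remaining Bernoulli
   sum, which is O((ln n)^(-1/2)) near the thresholds.  The Bernoulli sum is
   treated by Stein's method.  The mean is an explicit sum of harmonic
   sums, and the variance follows from that of the martingale obtained by
   compensating the hits. *)

(** * Stein's equation for the normal law *)

(** Conditioning is expressed by testing against functions of the first [i] cards ([adapted]), so
    conditional statements become identities between finite averages over decks.

    The obstacle to trading hits lies at the bottom of the deck: with few cards left the remaining
    Bernoulli sum has small variance, and its point probabilities are not small. The way out is that
    the error on the largest multiplicity is bounded by the square of [proximity], a sum of ratios
    to the thresholds. One factor, divided by the number of cards left, has a bounded total; the
    other is tiny where the point probabilities are large. The same square controls the second
    moment of the accumulated error, which the variance requires.

    The score is normalised by its own mean and standard deviation, not by those of the Bernoulli
    sum. The Stein bound is therefore proved for arbitrary centering and scaling, with a term for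
    each mismatch: the means differ by O(1) and the variances by O((ln n)^(1/2)), so both terms are
    O((ln n)^(-1/2)). *)

Section Gauss.
Variable R : realType.
Implicit Types x w u : R.

Local Notation phi := (normal_pdf (0 : R) 1).
Definition Phi x : R := fine (std_normal_cdf x).

Lemma std_normal_cdfE x : std_normal_cdf x = (Phi x)%:E.
Proof. by rewrite /Phi fineK // /std_normal_cdf; exact: fin_num_measure. Qed.

Lemma Phi_ge0 x : 0 <= Phi x.
Proof. by apply: fine_ge0; exact: measure_ge0. Qed.

Lemma Phi_le1 x : Phi x <= 1.
Proof.
rewrite -lee_fin -std_normal_cdfE; exact: probability_le1.
Qed.

Lemma phi_gt0 x : 0 < phi x.
Proof. by rewrite normal_pdfE ?oner_neq0// mulr_gt0 ?expR_gt0 ?normal_peak_gt0 ?oner_neq0. Qed.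

Lemma is_derive_Phi x : is_derive x 1 Phi (phi x).
Proof.
have fi : lebesgue_measure.-integrable [set` `]-oo, (x + 1)]] (EFin \o phi).
  by apply: (integrableS _ _ (subsetT _)) => //=; exact: integrable_normal_pdf.
have ltNyx : ((-oo%O : itv_bound R) < BRight x)%E by rewrite ltNyr.
have [dF F'] := @continuous_FTC1 R phi -oo%O x (x + 1) (ltr_pwDr ltr01 (lexx x)) fi ltNyx
   (@continuous_normal_pdf R 0 1 (oner_neq0 _) x).
have -> : Phi = (fun x => (\int[lebesgue_measure]_(t in [set` `]-oo, x]]) (phi t))%R).
  by [].
by rewrite -F' derive1E; exact/derivableP.
Qed.

Let idR : measurableTypeR R -> R := idfun.

#[local] HB.instance Definition _ :=
  @isMeasurableFun.Build _ _ _ _ idR (@measurable_id _ _ setT).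

Lemma Phi_cvgy : Phi x @[x --> +oo] --> (1 : R).
Proof.
have h := cvg_cdfy1 (idR : {RV normal_prob (0 : R) 1 >-> R}).
exact: (fine_cvg h).
Qed.

Lemma Phi_cvgNy : Phi x @[x --> -oo] --> (0 : R).
Proof.
have h := cvg_cdfNy0 (idR : {RV normal_prob (0 : R) 1 >-> R}).
exact: (fine_cvg h).
Qed.

Lemma is_derive_expR_quad (c x : R) :
  is_derive x 1 (fun y => expR (c * y ^+ 2)) (2 * c * x * expR (c * x ^+ 2)).
Proof.
have d1 : is_derive x 1 (fun y : R => c * y ^+ 2) (c * (2 * x)).
  have := @is_deriveZ R R R (fun y : R => y ^+ 2) c x 1 (2 * x).
  apply; have := @is_deriveX R R id 2 x 1 1 (is_derive_id x 1).
  by rewrite /= expr1 /GRing.scale /= mulr1.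
have := @is_derive1_comp R expR (fun y => c * y ^+ 2) x _ _ (is_derive_expR _) d1.
by move=> /is_derive_eq; apply; ring.
Qed.

Lemma phiE x : phi x = normal_peak 1 * expR (- 2^-1 * x ^+ 2).
Proof.
rewrite normal_pdfE ?oner_neq0//= /normal_fun subr0 expr1n.
by congr (_ * expR _); rewrite mulNr mulrC mulNr.
Qed.

Lemma is_derive_phi x : is_derive x 1 phi (- x * phi x).
Proof.
have -> : phi = (fun y => normal_peak 1 * expR (- 2^-1 * y ^+ 2)).
  by apply/funext => y; exact: phiE.
have := @is_deriveZ R R R (fun y => expR (- 2^-1 * y ^+ 2)) (normal_peak 1) x 1 _
   (is_derive_expR_quad (- 2^-1) x).
move=> /is_derive_eq; apply; rewrite /GRing.scale /=; lra.
Qed.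

(** The reciprocal of the density, and the solution of the homogeneous equation f'(w) = w f(w). *)
Definition invphi x : R := (normal_peak 1)^-1 * expR (2^-1 * x ^+ 2).

Lemma phi_invphi x : phi x * invphi x = 1.
Proof.
have p0 : normal_peak (1 : R) != 0 by rewrite gt_eqF ?normal_peak_gt0 ?oner_neq0.
by rewrite phiE /invphi mulrACA divff// mul1r -expRD -mulrDl addNr mul0r expR0.
Qed.

Lemma invphi_gt0 x : 0 < invphi x.
Proof.
have p0 : 0 < normal_peak (1 : R) by rewrite normal_peak_gt0 ?oner_neq0.
apply: mulr_gt0; last exact: expR_gt0.
by rewrite invr_gt0.
Qed.

Lemma is_derive_invphi x : is_derive x 1 invphi (x * invphi x).
Proof.
have := @is_deriveZ R R R (fun y => expR (2^-1 * y ^+ 2)) (normal_peak 1)^-1 x 1 _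
   (is_derive_expR_quad (2^-1) x).
move=> /is_derive_eq; apply; rewrite /GRing.scale /= /invphi; lra.
Qed.

Lemma is_derive_continuous (f df : R -> R) :
  (forall x, is_derive x 1 f (df x)) -> continuous f.
Proof.
move=> h x; apply: differentiable_continuous.
by apply/derivable1_diffP; have [] := h x.
Qed.

Lemma MVT_everywhere (f df : R -> R) (a b : R) : a <= b ->
  (forall x, is_derive x 1 f (df x)) ->
  exists2 c, a <= c <= b & f b - f a = df c * (b - a).
Proof.
move=> ab h.
have [c + e] := MVT_segment ab (fun x _ => h x)
  (continuous_subspaceT (is_derive_continuous h)).
by rewrite in_itv /= => ?; exists c.
Qed.

(** On u >= w the derivative (w - u) phi(u) of [K] is nonpositive, so w Phi(u) <= K(u) <= K(w); then
    u tends to infinity. *)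
Lemma mills_right w : 0 < w -> w * (1 - Phi w) <= phi w.
Proof.
move=> w0; pose K u := phi u + w * Phi u.
have dK u : is_derive u 1 K (- u * phi u + w * phi u).
  apply: (@is_deriveD R R R phi (fun u => w * Phi u)); first exact: is_derive_phi.
  exact: (@is_deriveZ R R R Phi w u 1 _ (is_derive_Phi u)).
have Kle u : w <= u -> w * Phi u <= K w.
  move=> wu; have [c /andP[wc cu] e] := MVT_everywhere wu dK.
  have : K u - K w <= 0.
    by rewrite e -mulrDl mulr_le0_ge0 ?subr_ge0// mulr_le0_ge0 ?(ltW (phi_gt0 _)) //; lra.
  rewrite {1}/K; have := phi_gt0 u; lra.
suff : w * 1 <= K w by rewrite /K; lra.
have lim : w * Phi u @[u --> +oo] --> (w * 1 : R).
  by apply: cvgM; [exact: cvg_cst|exact: Phi_cvgy].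
apply: (cvgr_to_le lim).
by near=> u; apply: Kle; near: u; exact: (nbhs_pinfty_ge (num_real w)).
Unshelve. all: by end_near. Qed.

Lemma mills_left w : w < 0 -> - w * Phi w <= phi w.
Proof.
move=> w0; pose K u := phi u + w * Phi u.
have dK u : is_derive u 1 K (- u * phi u + w * phi u).
  apply: (@is_deriveD R R R phi (fun u => w * Phi u)); first exact: is_derive_phi.
  exact: (@is_deriveZ R R R Phi w u 1 _ (is_derive_Phi u)).
have Kle u : u <= w -> w * Phi u <= K w.
  move=> uw; have [c /andP[uc cw] e] := MVT_everywhere uw dK.
  have : 0 <= K w - K u.
    by rewrite e -mulrDl mulr_ge0 ?subr_ge0// mulr_ge0 ?(ltW (phi_gt0 _)) //; lra.
  rewrite {2}/K; have := phi_gt0 u; lra.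
suff : w * 0 <= K w by rewrite /K; lra.
have lim : w * Phi u @[u --> -oo] --> (w * 0 : R).
  by apply: cvgM; [exact: cvg_cst|exact: Phi_cvgNy].
apply: (cvgr_to_le lim).
by near=> u; apply: Kle; near: u; exact: (nbhs_ninfty_le (num_real w)).
Unshelve. all: by end_near. Qed.

(** * Solution of Stein's equation for the indicator of a half-line *)

Section SteinSolution.
Variable x : R.

Definition stein_left w := (1 - Phi x) * (Phi w * invphi w).
Definition stein_right w := Phi x * ((1 - Phi w) * invphi w).
(** The bounded solution of f'(w) - w f(w) = 1{w <= x} - Phi(x). *)
Definition stein_sol w := if w <= x then stein_left w else stein_right w.
(** Read off the equation: the derivative of [stein_sol] away from x, its left derivative at x. *)
Definition stein_deriv w : R := w * stein_sol w + ((w <= x)%R%:R - Phi x).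

Lemma is_derive_stein_left w :
  is_derive w 1 stein_left (w * stein_left w + (1 - Phi x)).
Proof.
have d := @is_deriveZ R R R _ (1 - Phi x) w 1 _
  (is_deriveM (is_derive_Phi w) (is_derive_invphi w)).
move: d => /is_derive_eq; apply; rewrite /stein_left /GRing.scale /=.
by rewrite [_ * phi w]mulrC phi_invphi; ring.
Qed.

Lemma is_derive_stein_right w :
  is_derive w 1 stein_right (w * stein_right w - Phi x).
Proof.
have d1 : is_derive w 1 (fun y : R => 1 - Phi y) (- phi w).
  have := @is_deriveB R R R (fun=> 1) Phi w 1 _ _ (is_derive_cst (1 : R) w 1) (is_derive_Phi w).
  by move=> /is_derive_eq; apply; rewrite sub0r.
have d := @is_deriveZ R R R _ (Phi x) w 1 _
  (is_deriveM d1 (is_derive_invphi w)).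
move: d => /is_derive_eq; apply; rewrite /stein_right /GRing.scale /=.
by rewrite [_ * - phi w]mulrC mulNr phi_invphi; ring.
Qed.

Lemma stein_rightE : stein_right x = stein_left x.
Proof. by rewrite /stein_left /stein_right; ring. Qed.

Lemma Phi_homo u w : u <= w -> Phi u <= Phi w.
Proof.
move=> uw; have [c _ e] := MVT_everywhere uw is_derive_Phi.
by rewrite -subr_ge0 e mulr_ge0 ?subr_ge0// ltW ?phi_gt0.
Qed.

Lemma stein_sol_ge0 w : 0 <= stein_sol w.
Proof.
have i0 := ltW (invphi_gt0 w); have := Phi_ge0; have := Phi_le1 => p1 p0.
by rewrite /stein_sol; case: ifP => _; apply: mulr_ge0; rewrite ?subr_ge0//;
  apply: mulr_ge0; rewrite ?subr_ge0.
Qed.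

Lemma stein_sol_le_right w : stein_sol w <= (1 - Phi w) * invphi w.
Proof.
have := Phi_ge0 x; have := Phi_le1 x; have := Phi_ge0 w; have := Phi_le1 w.
rewrite /stein_sol; case: ifP => [wx|_] a b c d; last first.
  by rewrite ler_piMl// mulr_ge0 ?subr_ge0// ltW ?invphi_gt0.
rewrite /stein_left mulrA ler_wpM2r ?(ltW (invphi_gt0 _))//.
apply: (@le_trans _ _ (1 - Phi x)); last by rewrite lerB ?Phi_homo.
by rewrite ler_piMr ?subr_ge0.
Qed.

Lemma stein_sol_le_left w : stein_sol w <= Phi w * invphi w.
Proof.
have := Phi_ge0 x; have := Phi_le1 x; have := Phi_ge0 w; have := Phi_le1 w.
rewrite /stein_sol; case: ifPn; rewrite -?ltNge => wx a b c d.
  by rewrite ler_piMl//; [rewrite mulr_ge0// ltW ?invphi_gt0|lra].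
rewrite /stein_right mulrA ler_wpM2r ?(ltW (invphi_gt0 _))//.
apply: (@le_trans _ _ (Phi x)); last exact: Phi_homo (ltW wx).
by rewrite ler_piMr // lerBlDr lerDl.
Qed.

(** Either one-sided bound on [stein_sol] holds wherever x lies, so the sign of w decides which
    Mills inequality to use. *)
Lemma stein_sol_mul_le1 w : `|w * stein_sol w| <= 1.
Proof.
rewrite normrM (ger0_norm (stein_sol_ge0 w)).
have i0 := invphi_gt0 w.
have [w0|w0|->] := ltgtP w 0; last by rewrite normr0 mul0r.
- rewrite ltr0_norm//; apply: (@le_trans _ _ (- w * (Phi w * invphi w))).
    by rewrite ler_wpM2l ?stein_sol_le_left//; lra.
  by rewrite mulrA -[leRHS](phi_invphi w); apply: ler_wpM2r; [exact: ltW|exact: mills_left].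
- rewrite gtr0_norm//; apply: (@le_trans _ _ (w * ((1 - Phi w) * invphi w))).
    by rewrite ler_wpM2l ?stein_sol_le_right// ltW.
  by rewrite mulrA -[leRHS](phi_invphi w); apply: ler_wpM2r; [exact: ltW|exact: mills_right].
Qed.

Lemma stein_deriv_le2 w : `|stein_deriv w| <= 2.
Proof.
apply: le_trans (ler_normD _ _) _; apply: (@lerD _ _ 1 _ 1).
  exact: stein_sol_mul_le1.
by have := Phi_ge0 x; have := Phi_le1 x; rewrite ler_norml; case: (w <= x) => /=; lra.
Qed.

Definition stein_bound : R := 1 + invphi 1.

Lemma stein_bound_ge1 : 1 <= stein_bound.
Proof. by rewrite /stein_bound lerDl ltW ?invphi_gt0. Qed.

(** For |w| >= 1 this follows from the bound on w f(w); for |w| < 1 the factor 1 / phi is at most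
    its value at 1. *)
Lemma stein_sol_le w : `|stein_sol w| <= stein_bound.
Proof.
have s0 := stein_sol_ge0 w; have := stein_sol_mul_le1 w.
rewrite normrM (ger0_norm s0) /stein_bound.
have [w1 h|w1 _] := leP 1 `|w|.
  have w2 : 1 * stein_sol w <= `|w| * stein_sol w by rewrite ler_wpM2r.
  by have := invphi_gt0 1; lra.
have : stein_sol w <= 1 * invphi w.
  apply: le_trans (stein_sol_le_left w) _; rewrite ler_wpM2r ?Phi_le1//.
  exact: ltW (invphi_gt0 _).
have : invphi w <= invphi 1.
  rewrite /invphi ler_wpM2l ?invr_ge0 ?normal_peak_ge0// ler_expR ler_wpM2l//.
  by rewrite expr1n -(real_normK (num_real w)) expr_le1// ltW.
by lra.
Qed.

Lemma stein_sol_left w : w <= x -> stein_sol w = stein_left w.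
Proof. by rewrite /stein_sol => ->. Qed.

Lemma stein_sol_right w : x <= w -> stein_sol w = stein_right w.
Proof.
rewrite /stein_sol le_eqVlt => /predU1P[<-|xw].
  by rewrite lexx stein_rightE.
by rewrite leNgt xw.
Qed.

Lemma stein_sol_MVT_left a b : a <= b -> b <= x ->
  exists2 c, a <= c <= b & stein_sol b - stein_sol a = stein_deriv c * (b - a).
Proof.
move=> ab bx; have [c /andP[ac cb] e] := MVT_everywhere ab is_derive_stein_left.
exists c; first by rewrite ac.
rewrite !stein_sol_left ?(le_trans ab)// e /stein_deriv.
by rewrite stein_sol_left ?(le_trans cb)//.
Qed.

(** At x [stein_deriv] takes the left value, so the slope is identified with it only when x < a; the
    bound 2 holds in any case. *)
Lemma stein_sol_MVT_right a b : a <= b -> x <= a ->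
  exists2 D, `|D| <= 2 /\ (x < a -> exists2 c, a <= c <= b & D = stein_deriv c) &
  stein_sol b - stein_sol a = D * (b - a).
Proof.
move=> ab xa; have [c /andP[ac cb] e] := MVT_everywhere ab is_derive_stein_right.
exists (c * stein_right c - Phi x); last first.
  by rewrite !stein_sol_right ?(le_trans xa)// e.
rewrite -stein_sol_right ?(le_trans xa)//; split.
  have := stein_sol_mul_le1 c; have := Phi_ge0 x; have := Phi_le1 x.
  by rewrite !ler_norml; lra.
move=> xa'; exists c; first by rewrite ac.
by rewrite /stein_deriv leNgt (lt_le_trans xa' ac) /= sub0r.
Qed.

Lemma stein_sol_lip a b : a <= b -> `|stein_sol b - stein_sol a| <= 2 * (b - a).
Proof.
have left u v : u <= v -> v <= x -> `|stein_sol v - stein_sol u| <= 2 * (v - u).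
  move=> uv vx; have [c _ ->] := stein_sol_MVT_left uv vx.
  by rewrite normrM [X in _ * X]ger0_norm ?subr_ge0// ler_wpM2r ?subr_ge0// stein_deriv_le2.
have right u v : u <= v -> x <= u -> `|stein_sol v - stein_sol u| <= 2 * (v - u).
  move=> uv xu; have [D [D2 _] ->] := stein_sol_MVT_right uv xu.
  by rewrite normrM [X in _ * X]ger0_norm ?subr_ge0// ler_wpM2r ?subr_ge0.
move=> ab; have [bx|xb] := leP b x; first exact: left.
have [xa|ax] := leP x a; first exact: right.
have l1 := left _ _ (ltW ax) (lexx x); have l2 := right _ _ (ltW xb) (lexx x).
have -> : stein_sol b - stein_sol a =
  (stein_sol b - stein_sol x) + (stein_sol x - stein_sol a) by ring.
by apply: le_trans (ler_normD _ _) _; lra.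
Qed.

(** If the step does not cross x, the mean value point c lies on the same side of x as u, the
    indicators cancel, and the slopes differ by c (f(c) - f(u)) + (c - u) f(u), which is of order d.
    Both ends are allowed for u because the summand omitted in [bern_loo] may be 0 or 1. *)
Lemma stein_sol_increment w d u : 0 <= d -> ~~ (w <= x < w + d) ->
  u = w \/ u = w + d ->
  `|stein_sol (w + d) - stein_sol w - d * stein_deriv u|
  <= d ^+ 2 * (3 * stein_bound + 2 * `|w| + 2 * d).
Proof.
move=> d0 wxd uE.
have ab : w <= w + d by rewrite lerDl.
have [c [/andP[wc cw] e] hx] : exists2 c,
    w <= c <= w + d /\ stein_sol (w + d) - stein_sol w = stein_deriv c * d &
    (c <= x)%R = (u <= x)%R.
  have dE : w + d - w = d by ring.
  have [xw|wx] := ltP x w.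
    have [D [_ /(_ xw)[c cI ->]]] := stein_sol_MVT_right ab (ltW xw).
    rewrite dE; exists c => //; case/andP: cI => wc _.
    have ux : x < u by case: uE => ->; lra.
    by rewrite !leNgt (lt_le_trans xw wc) ux.
  have wdx : w + d <= x by move: wxd; rewrite wx /= -leNgt.
  have [c cI] := stein_sol_MVT_left ab wdx; rewrite dE => e.
  exists c => //; case/andP: cI => _ cw.
  have -> : u <= x by case: uE => ->.
  by rewrite (le_trans cw).
have uI : w <= u <= w + d by case: uE => ->; rewrite lexx ?ab.
have cu : `|stein_sol c - stein_sol u| <= 2 * d.
  have [cu|uc] := leP c u.
    by have := stein_sol_lip cu; rewrite distrC; lra.
  by have := stein_sol_lip (ltW uc); lra.
have -> : stein_sol (w + d) - stein_sol w - d * stein_deriv u =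
    d * (c * (stein_sol c - stein_sol u) + (c - u) * stein_sol u).
  by rewrite e /stein_deriv hx; ring.
rewrite normrM (ger0_norm d0) expr2 -mulrA ler_wpM2l//.
apply: le_trans (ler_normD _ _) _; rewrite !normrM.
have c1 : `|c| <= `|w| + d.
  have -> : c = w + (c - w) by ring.
  by apply: le_trans (ler_normD _ _) _; rewrite lerD2l ger0_norm; lra.
have c2 : `|c - u| <= d by rewrite ler_norml; lra.
have sb := stein_sol_le u; have b1 := stein_bound_ge1.
have : `|c| * `|stein_sol c - stein_sol u| <= (`|w| + d) * (2 * d) by rewrite ler_pM.
have : `|c - u| * `|stein_sol u| <= d * stein_bound by rewrite ler_pM.
have := normr_ge0 w; nra.
Qed.

End SteinSolution.
End Gauss.

(** * Sums of independent Bernoulli variables *)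

Section BernoulliSum.
Variables (R : realType) (p : nat -> R).
Hypothesis p01 : forall i, 0 <= p i <= 1.
Implicit Types (f g h k : nat -> R) (n s : nat).

(* [bern_exp n f s] is the expectation of [f (s + X_0 + ... + X_(n-1))] for
   independent Bernoulli variables [X_i] of parameters [p i]. *)
Fixpoint bern_exp n f s : R :=
  if n is n'.+1 then (1 - p n') * bern_exp n' f s + p n' * bern_exp n' f s.+1
  else f s.

(* The sum over [i < n] of [p i * (1 - p i)] times the expectation of [f] at
   [s] plus the sum of the [X_j] with [j != i]. *)
Fixpoint bern_loo n f s : R :=
  if n is n'.+1 then
    p n' * (1 - p n') * bern_exp n' f s
    + ((1 - p n') * bern_loo n' f s + p n' * bern_loo n' f s.+1)
  else 0.

Definition bern_mean n : R := \sum_(i < n) p i.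
Definition bern_var n : R := \sum_(i < n) p i * (1 - p i).

Let p0 i : 0 <= p i. Proof. by have /andP[] := p01 i. Qed.
Let q0 i : 0 <= 1 - p i. Proof. by have /andP[] := p01 i; rewrite subr_ge0. Qed.

Lemma bern_meanS n : bern_mean n.+1 = bern_mean n + p n.
Proof. by rewrite /bern_mean big_ord_recr. Qed.

Lemma bern_varS n : bern_var n.+1 = bern_var n + p n * (1 - p n).
Proof. by rewrite /bern_var big_ord_recr. Qed.

Lemma bern_var_ge0 n : 0 <= bern_var n.
Proof. by apply: sumr_ge0 => i _; exact: mulr_ge0. Qed.

Lemma eq_bern_exp n f g s : f =1 g -> bern_exp n f s = bern_exp n g s.
Proof. by move=> fg; congr bern_exp; apply/funext. Qed.

Lemma bern_exp_le n f g s : (forall i, f i <= g i) -> bern_exp n f s <= bern_exp n g s.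
Proof.
move=> fg; elim: n s => [//|n IH] s /=.
by rewrite lerD// ler_wpM2l.
Qed.

Lemma bern_exp_lin n (a b : R) f g s :
  bern_exp n (fun i => a * f i + b * g i) s = a * bern_exp n f s + b * bern_exp n g s.
Proof. by elim: n s => [//|n IH] s /=; rewrite !IH; ring. Qed.

Lemma bern_exp_cst n (c : R) s : bern_exp n (fun=> c) s = c.
Proof. by elim: n s => [//|n IH] s /=; rewrite !IH; ring. Qed.

Lemma bern_expB n f g s :
  bern_exp n (fun i => f i - g i) s = bern_exp n f s - bern_exp n g s.
Proof. by elim: n s => [//|n IH] s /=; rewrite !IH; ring. Qed.

Lemma bern_expS n f s : bern_exp n f s.+1 = bern_exp n (fun i => f i.+1) s.
Proof. by elim: n s => [//|n IH] s /=; rewrite !IH. Qed.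

Lemma bern_loo_lin n (a b : R) f g s :
  bern_loo n (fun i => a * f i + b * g i) s = a * bern_loo n f s + b * bern_loo n g s.
Proof.
by elim: n s => [|n IH] s /=; rewrite ?IH ?bern_exp_lin; ring.
Qed.

Lemma bern_loo_cst n (c : R) s : bern_loo n (fun=> c) s = c * bern_var n.
Proof.
elim: n s => [|n IH] s /=; first by rewrite /bern_var big_ord0 mulr0.
by rewrite !IH bern_exp_cst bern_varS; ring.
Qed.

(** Discrete counterpart of Gaussian integration by parts: (X_i - p_i) F(X_i) has mean p_i (1 - p_i)
    (F(1) - F(0)). The variance, the point probabilities and the Stein bound are all derived from
    it. *)
Lemma bern_exp_centered n f s :
  bern_exp n (fun i => (i%:R - s%:R - bern_mean n) * f i) s
  = bern_loo n (fun i => f i.+1 - f i) s.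
Proof.
elim: n s => [|n IH] s /=; first by rewrite /bern_mean big_ord0 subrr subr0 mul0r.
have e1 : bern_exp n (fun i => (i%:R - s%:R - bern_mean n.+1) * f i) s =
   bern_loo n (fun i => f i.+1 - f i) s - p n * bern_exp n f s.
  rewrite -IH -[X in X - _]mul1r -mulNr -bern_exp_lin.
  by apply: eq_bern_exp => i; rewrite bern_meanS; ring.
have e2 : bern_exp n (fun i => (i%:R - s%:R - bern_mean n.+1) * f i) s.+1 =
   bern_loo n (fun i => f i.+1 - f i) s.+1 + (1 - p n) * bern_exp n f s.+1.
  rewrite -IH -[X in X + _]mul1r -bern_exp_lin.
  by apply: eq_bern_exp => i; rewrite bern_meanS -[s.+1]addn1 natrD; ring.
have e3 : bern_exp n (fun i => f i.+1 - f i) s = bern_exp n f s.+1 - bern_exp n f s.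
  by rewrite bern_expS -bern_expB.
by rewrite e1 e2 e3; ring.
Qed.

Lemma bern_exp_variance n s :
  bern_exp n (fun i => (i%:R - s%:R - bern_mean n) ^+ 2) s = bern_var n.
Proof.
rewrite -[RHS]mul1r -(bern_loo_cst n 1 s).
under eq_bern_exp do rewrite expr2.
rewrite (bern_exp_centered n (fun i => i%:R - s%:R - bern_mean n)).
congr bern_loo; apply/funext => i; rewrite -[i.+1]addn1 natrD; ring.
Qed.

(** Restoring the omitted summand adds 0 or 1 to the argument, and g dominates f in both cases. *)
Lemma bern_loo_le_exp n f g s : (forall i, f i <= g i) -> (forall i, f i <= g i.+1) ->
  bern_loo n f s <= bern_var n * bern_exp n g s.
Proof.
move=> fg fgS; elim: n s => [|n IH] s /=.
  by rewrite /bern_var big_ord0 mul0r.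
have h1 := bern_exp_le n s fg.
have h2 : bern_exp n f s <= bern_exp n g s.+1 by rewrite bern_expS bern_exp_le.
have h3 : bern_exp n f s <= (1 - p n) * bern_exp n g s + p n * bern_exp n g s.+1.
  have -> : bern_exp n f s = (1 - p n) * bern_exp n f s + p n * bern_exp n f s by ring.
  by rewrite lerD// ler_wpM2l.
rewrite bern_varS [leRHS]mulrDl [leRHS]addrC lerD//;
  first by rewrite ler_wpM2l// mulr_ge0.
have -> : bern_var n * ((1 - p n) * bern_exp n g s + p n * bern_exp n g s.+1) =
  (1 - p n) * (bern_var n * bern_exp n g s) + p n * (bern_var n * bern_exp n g s.+1).
  by ring.
by rewrite lerD// ler_wpM2l.
Qed.

Lemma bern_exp_le_loo n f g s : (forall i, g i <= f i) -> (forall i, g i.+1 <= f i) ->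
  bern_var n * bern_exp n g s <= bern_loo n f s.
Proof.
move=> gf gSf.
(* The zero second terms only put the negations into the shape of the linearity lemmas. *)
have := @bern_loo_le_exp n (fun i => -1 * f i + 0 * 0) (fun i => -1 * g i + 0 * 0) s.
rewrite (bern_loo_lin n (-1) 0 f (fun=> 0)) (bern_exp_lin n (-1) 0 g (fun=> 0)).
rewrite !mul0r !addr0 !mulN1r mulrN lerN2; apply => i; rewrite !mulN1r ?mulr0 !addr0 lerN2.
- exact: gf.
- exact: gSf.
Qed.

Lemma bern_exp_norm n f s : `|bern_exp n f s| <= bern_exp n (fun i => `|f i|) s.
Proof.
elim: n s => [//|n IH] s /=.
by apply: le_trans (ler_normD _ _) _; rewrite !normrM (ger0_norm (q0 n)) (ger0_norm (p0 n)) lerD// ler_wpM2l.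
Qed.

(** The inequality |x| <= x^2 / (2 r) + r / 2 takes the place of Cauchy-Schwarz. *)
Lemma bern_abs_dev n s (r : R) : 0 < r -> bern_var n <= r ^+ 2 ->
  bern_exp n (fun i => `|i%:R - s%:R - bern_mean n|) s <= r.
Proof.
move=> r0 vr.
have -> : r = (2 * r)^-1 * r ^+ 2 + (r / 2) by field; rewrite gt_eqF.
apply: (@le_trans _ _ ((2 * r)^-1 * bern_var n + r / 2)); last first.
  by rewrite lerD2r ler_wpM2l ?invr_ge0//; nra.
rewrite -(bern_exp_variance n s).
have -> : r / 2 = r / 2 * bern_exp n (fun=> 1) s by rewrite bern_exp_cst mulr1.
rewrite -bern_exp_lin.
apply: bern_exp_le => i; set x := i%:R - s%:R - bern_mean n.
rewrite mulr1 -(real_normK (num_real x)).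
have : 0 <= (2 * r)^-1 * (`|x| - r) ^+ 2 by rewrite mulr_ge0 ?sqr_ge0 ?invr_ge0//; lra.
suff -> : (2 * r)^-1 * (`|x| - r) ^+ 2 = (2 * r)^-1 * `|x| ^+ 2 + r / 2 - `|x| by rewrite subr_ge0.
by field; rewrite gt_eqF.
Qed.

(** Apply [bern_exp_centered] to the sign of i - a. Its increments 1{i = a} + 1{i + 1 = a} dominate
    the point mass whichever value the omitted summand takes, and the centered side is at most the
    mean absolute deviation. *)
Lemma bern_point_le n s (a : nat) (r : R) : 0 < r -> r ^+ 2 <= bern_var n ->
  bern_exp n (fun i => (i == a)%:R) s <= r^-1.
Proof.
move=> r0 rv; have v0 : 0 < bern_var n by rewrite (lt_le_trans _ rv)// exprn_gt0.
pose sg := Num.sqrt (bern_var n).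
have sg0 : 0 < sg by rewrite sqrtr_gt0.
have sgE : sg ^+ 2 = bern_var n by rewrite sqr_sqrtr// ltW.
pose g i : R := (a < i)%N%:R + (a <= i)%N%:R - 1.
have gE i : g i.+1 - g i = (i == a)%:R + (i.+1 == a)%:R.
  rewrite /g ltnS; have [ia|ia|->] := ltngtP i a.
  - by rewrite eqn_leq ia /=; ring.
  - by rewrite (leqW (ltnW ia)) gtn_eqF ?leqW//=; ring.
  - by rewrite leqnSn (gtn_eqF (ltnSn a)) /=; ring.
have g1 i : `|g i| <= 1.
  by rewrite /g ler_norml; have [h|h|h] := ltngtP a i; rewrite /=; lra.
have : bern_var n * bern_exp n (fun i => (i == a)%:R) s <= sg.
  apply: le_trans (bern_exp_le_loo (f := fun i => g i.+1 - g i) _ _ _ _) _.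
  - by move=> i; rewrite gE lerDl.
  - by move=> i; rewrite gE lerDr.
  rewrite -bern_exp_centered; apply: le_trans (ler_norm _) _.
  apply: le_trans (bern_exp_norm _ _ _) _.
  have svar : bern_var n <= sg ^+ 2 by rewrite sgE.
  apply: le_trans (bern_abs_dev s sg0 svar).
  apply: bern_exp_le => i; rewrite normrM -[leRHS]mulr1.
  by rewrite ler_wpM2l.
move=> h.
have h2 : bern_exp n (fun i => (i == a)%:R) s <= sg^-1.
  rewrite -(ler_pM2l v0) (le_trans h)// -sgE expr2 -mulrA divff ?mulr1// gt_eqF//.
apply: le_trans h2 _; rewrite lef_pV2 ?posrE//.
by rewrite -ler_sqr ?nnegrE ?(ltW r0) ?(ltW sg0)// sgE.
Qed.

(** * Stein bound for a Bernoulli sum with arbitrary centering and scaling *)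

Section SteinBound.
Variables (mu sg x : R).
Hypothesis sg1 : 1 <= sg.

Let wt i : R := (i%:R - mu) / sg.
Let f i := stein_sol x (wt i).
Let h i := stein_deriv x (wt i).
Let b n : R := (bern_mean n - mu) / sg.
Let C : R := stein_bound R.

Let sg0 : 0 < sg. Proof. exact: lt_le_trans ltr01 sg1. Qed.
Let sgn0 : sg != 0. Proof. by rewrite gt_eqF. Qed.

Let wtS i : wt i.+1 = wt i + sg^-1.
Proof. by rewrite /wt -addn1 natrD; field. Qed.

Let crossing i : R := (wt i <= x < wt i + sg^-1)%R%:R.

(** At a crossing, where the second-order bound fails, the increment and the slope term are each at
    most 2 / sg. *)
Let err i : R := sg^-1 ^+ 2 * (3 * C + 2 * `|wt i| + 2) + 4 * sg^-1 * crossing i.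

Let sgV1 : sg^-1 <= 1. Proof. by rewrite invf_le1. Qed.
Let sgV0 : 0 < sg^-1. Proof. by rewrite invr_gt0. Qed.

Let increment i u : u = wt i \/ u = wt i + sg^-1 ->
  `|f i.+1 - f i - sg^-1 * stein_deriv x u| <= err i.
Proof.
move=> uE; rewrite /f wtS /err /crossing.
have b1 := stein_bound_ge1 R; have w0 := normr_ge0 (wt i).
have [cr|ncr] := boolP (wt i <= x < wt i + sg^-1); last first.
  apply: le_trans (stein_sol_increment (ltW sgV0) ncr uE) _.
  by rewrite mulr0 addr0 ler_wpM2l ?sqr_ge0// lerD2l -[leRHS]mulr1 ler_wpM2l.
apply: le_trans (ler_normB _ _) _.
have l1 : wt i <= wt i + sg^-1 by rewrite lerDl ltW.
have := stein_sol_lip x l1; have := stein_deriv_le2 x u.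
rewrite normrM (ger0_norm (ltW sgV0)) [wt i + _ - _]addrAC subrr add0r => h1 h2.
have h3 : sg^-1 * `|stein_deriv x u| <= sg^-1 * 2 by rewrite ler_wpM2l// ltW.
have h4 : 0 <= sg^-1 ^+ 2 * (3 * C + 2 * `|wt i| + 2).
  by rewrite mulr_ge0 ?sqr_ge0// /C; lra.
by rewrite mulr1; lra.
Qed.

(** Crossings are the increments of 1{x < wt i}, so [bern_exp_centered] bounds their weighted sum by
    the mean absolute deviation. *)
Let loo_crossing n s : bern_var n <= 4 * sg ^+ 2 -> bern_loo n crossing s <= 2 * sg.
Proof.
move=> vn.
pose g i : R := (x < wt i)%R%:R.
have -> : crossing = (fun i => g i.+1 - g i).
  apply/funext => i; rewrite /g wtS /crossing (ltNge x (wt i)) (ltNge x (wt i + sg^-1)).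
  case: (leP (wt i) x) => h1 /=; case: (leP (wt i + sg^-1) x) => h2 /=; try lra.
  by have := le_lt_trans h2 h1; rewrite gtrDl ltNge (ltW sgV0).
rewrite -bern_exp_centered; apply: le_trans (ler_norm _) _.
apply: le_trans (bern_exp_norm _ _ _) _.
have sg2 : 0 < 2 * sg by rewrite mulr_gt0.
have svar : bern_var n <= (2 * sg) ^+ 2 by rewrite exprMn; lra.
apply: le_trans (bern_abs_dev s sg2 svar).
apply: bern_exp_le => i; rewrite normrM -[leRHS]mulr1 ler_wpM2l// /g.
by case: (_ < _); rewrite /= ?normr1 ?normr0.
Qed.

Let exp_abs_wt n : bern_var n <= 4 * sg ^+ 2 ->
  bern_exp n (fun i => `|wt i|) 0 <= 2 + `|b n|.
Proof.
move=> vn; apply: (@le_trans _ _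
   (bern_exp n (fun i => sg^-1 * `|i%:R - 0%:R - bern_mean n| + `|b n| * 1) 0)).
  apply: bern_exp_le => i.
  have -> : wt i = sg^-1 * (i%:R - 0%:R - bern_mean n) + b n.
    by rewrite /wt /b subr0; field.
  by apply: le_trans (ler_normD _ _) _; rewrite normrM (gtr0_norm sgV0) mulr1.
rewrite bern_exp_lin bern_exp_cst mulr1 lerD2r.
have h1 : bern_exp n (fun i => `|i%:R - 0%:R - bern_mean n|) 0 <= 2 * sg.
  by apply: bern_abs_dev; [rewrite mulr_gt0|rewrite exprMn; lra].
have -> : 2 = sg^-1 * (2 * sg) by field.
by rewrite ler_wpM2l// ltW.
Qed.

Let loo_abs_wt n : bern_var n <= 4 * sg ^+ 2 ->
  bern_loo n (fun i => `|wt i|) 0 <= bern_var n * (3 + `|b n|).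
Proof.
move=> vn.
apply: le_trans (bern_loo_le_exp (g := fun i => 1 * `|wt i| + 1 * 1) _ _ _ _) _.
- by move=> i; rewrite mul1r mulr1 lerDl.
- move=> i; rewrite mul1r mulr1 wtS.
  have -> : wt i = (wt i + sg^-1) - sg^-1 by rewrite addrK.
  apply: le_trans (ler_normB _ _) _.
  by rewrite addrK (gtr0_norm sgV0) lerD2l.
rewrite ler_wpM2l ?bern_var_ge0// bern_exp_lin bern_exp_cst.
by have := exp_abs_wt vn; lra.
Qed.

(** Stein's equation is averaged at (W - mu) / sg. The terms come from the mismatch of the variance
    with sg^2 (slope at most 2), from the mismatch [b n] of the mean (solution at most C), and from
    the remainders [err]. *)
Lemma bern_stein n : bern_var n <= 4 * sg ^+ 2 -> `|b n| <= 1 ->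
  `|bern_exp n (fun i => ((i%:R - mu) / sg <= x)%R%:R) 0 - Phi x| <=
  2 * `|1 - bern_var n / sg ^+ 2| + C * `|b n| + (12 * C + 48) / sg.
Proof.
move=> vn b1; have v0 := bern_var_ge0 n; have C1 := stein_bound_ge1 R.
have hE : bern_exp n (fun i => ((i%:R - mu) / sg <= x)%R%:R) 0 - Phi x =
    bern_exp n h 0 - (sg^-1 * bern_loo n (fun i => f i.+1 - f i) 0 + b n * bern_exp n f 0).
  rewrite -bern_exp_centered -bern_exp_lin.
  rewrite -bern_expB.
  have ph : Phi x = bern_exp n (fun=> Phi x) 0 by rewrite bern_exp_cst.
  rewrite [X in _ - X = _]ph -bern_expB.
  apply: eq_bern_exp => i; rewrite /h /stein_deriv /b /f subr0 -/(wt i).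
  by set S := stein_sol x (wt i); rewrite /wt; field.
have err_bound : bern_loo n (fun i => sg * err i + 0 * 0) 0 <= sg * (12 * C + 48).
  rewrite (bern_loo_lin n sg 0 err (fun=> 0)) mul0r addr0 ler_wpM2l ?(ltW sg0)//.
  have -> : bern_loo n err 0 = sg^-1 ^+ 2 * ((3 * C + 2) * bern_var n
      + 2 * bern_loo n (fun i => `|wt i|) 0) + 4 * sg^-1 * bern_loo n crossing 0.
    rewrite -(bern_loo_cst n (3 * C + 2) 0) -[X in X + 2 * _]mul1r -!bern_loo_lin.
    by congr bern_loo; apply/funext => i; rewrite /err; ring.
  have l1 := loo_crossing 0 vn; have l2 := loo_abs_wt vn.
  have l3 : bern_loo n (fun i => `|wt i|) 0 <= bern_var n * 4.
    by apply: le_trans l2 _; rewrite ler_wpM2l//; lra.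
  (* The variance is at most 4 sg^2, which gives 4 (3 C + 2 + 2 * 4); the crossings give 4 * 2. *)
  have -> : 12 * C + 48 = sg^-1 ^+ 2 * ((3 * C + 10) * (4 * sg ^+ 2)) + 4 * sg^-1 * (2 * sg).
    by field.
  rewrite lerD// ler_wpM2l ?sqr_ge0 ?mulr_ge0 ?(ltW sgV0)//.
  apply: (@le_trans _ _ ((3 * C + 10) * bern_var n)); first by lra.
  by rewrite ler_wpM2l// /C; lra.
have inc i u : u = wt i \/ u = wt i + sg^-1 ->
    sg * (f i.+1 - f i) - sg * err i <= stein_deriv x u <= sg * (f i.+1 - f i) + sg * err i.
  move=> /increment; rewrite ler_distlC => /andP[i1 i2].
  have {1 2}-> : stein_deriv x u = sg * (sg^-1 * stein_deriv x u) by rewrite mulrA mulfV// mul1r.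
  by rewrite -mulrBr -mulrDr !ler_pM2l//; apply/andP; split; lra.
set L := bern_loo n (fun i => f i.+1 - f i) 0.
have up : bern_var n * bern_exp n h 0 <= sg * L + sg * (12 * C + 48).
  apply: le_trans (bern_exp_le_loo (f := fun i => sg * (f i.+1 - f i) + 1 * (sg * err i + 0 * 0)) _ _ _ _) _.
  - by move=> i; have /andP[_] := inc i (wt i) (or_introl erefl); rewrite /h; lra.
  - by move=> i; have /andP[_] := inc i (wt i.+1) (or_intror (wtS i)); rewrite /h; lra.
  by rewrite bern_loo_lin -/L mul1r lerD2l.
have low : sg * L - sg * (12 * C + 48) <= bern_var n * bern_exp n h 0.
  apply: le_trans (bern_loo_le_exp (f := fun i => sg * (f i.+1 - f i) + -1 * (sg * err i + 0 * 0)) _ _ _ _); last 2 first.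
  - by move=> i; have /andP[+ _] := inc i (wt i) (or_introl erefl); rewrite /h; lra.
  - by move=> i; have /andP[+ _] := inc i (wt i.+1) (or_intror (wtS i)); rewrite /h; lra.
  by rewrite bern_loo_lin -/L mulN1r lerD2l lerN2.
rewrite hE opprD addrA; apply: le_trans (ler_normB _ _) _.
rewrite [leRHS]addrAC lerD//.
  have -> : bern_exp n h 0 - sg^-1 * L = (1 - bern_var n / sg ^+ 2) * bern_exp n h 0
     + (sg ^+ 2)^-1 * (bern_var n * bern_exp n h 0 - sg * L) by field.
  apply: le_trans (ler_normD _ _) _; rewrite !normrM lerD//.
    rewrite mulrC ler_wpM2r//; apply: le_trans (bern_exp_norm _ _ _) _.
    rewrite -[leRHS](bern_exp_cst n 2 0); apply: bern_exp_le => i.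
    exact: stein_deriv_le2.
  have -> : (12 * C + 48) / sg = (sg ^+ 2)^-1 * (sg * (12 * C + 48)) by field.
  rewrite ger0_norm ?invr_ge0 ?sqr_ge0// ler_wpM2l ?invr_ge0 ?sqr_ge0//.
  by rewrite ler_norml; lra.
rewrite normrM mulrC ler_wpM2r//; apply: le_trans (bern_exp_norm _ _ _) _.
rewrite -[leRHS](bern_exp_cst n C 0); apply: bern_exp_le => i.
exact: stein_sol_le.
Qed.
End SteinBound.
End BernoulliSum.

(** * Exchangeability of the deck *)

Section DeckExpectation.
Variables (R : realType) (m n : nat).
Local Notation N := (m * n)%N.
Local Notation deck := (deck m n).
Implicit Types (w : deck) (f h : deck -> R) (i : nat) (a b : 'I_n).

Definition deck_exp f : R := (\sum_w f w) / #|{: deck}|%:R.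

Lemma card_deck_gt0 : (0 < #|{: deck}|%:R :> R).
Proof. by rewrite ltr0n; apply/card_gt0P; exists (sorted_deck m n). Qed.

Lemma deck_exp_lin (x y : R) f h :
  deck_exp (fun w => x * f w + y * h w) = x * deck_exp f + y * deck_exp h.
Proof. by rewrite /deck_exp big_split /= -!mulr_sumr; ring. Qed.

Lemma deck_expD f h : deck_exp (fun w => f w + h w) = deck_exp f + deck_exp h.
Proof. by rewrite /deck_exp big_split /= mulrDl. Qed.

Lemma deck_expB f h : deck_exp (fun w => f w - h w) = deck_exp f - deck_exp h.
Proof. by rewrite /deck_exp sumrB mulrBl. Qed.

Lemma deck_expZ (x : R) f : deck_exp (fun w => x * f w) = x * deck_exp f.
Proof. by rewrite /deck_exp -mulr_sumr mulrA. Qed.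

Lemma deck_exp_cst (x : R) : deck_exp (fun=> x) = x.
Proof.
rewrite /deck_exp sumr_const -[x *+ _]mulr_natr mulfK//.
by rewrite gt_eqF ?card_deck_gt0.
Qed.

Lemma deck_exp_sum (I : Type) (r : seq I) (P : pred I) (F : I -> deck -> R) :
  deck_exp (fun w => \sum_(j <- r | P j) F j w) = \sum_(j <- r | P j) deck_exp (F j).
Proof. by rewrite /deck_exp exchange_big /= mulr_suml. Qed.

Lemma deck_exp_le f h : (forall w, f w <= h w) -> deck_exp f <= deck_exp h.
Proof.
move=> fh; rewrite /deck_exp ler_wpM2r ?invr_ge0 ?(ltW card_deck_gt0)//.
by apply: ler_sum => w _.
Qed.

Lemma deck_exp_norm f : `|deck_exp f| <= deck_exp (fun w => `|f w|).
Proof.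
rewrite /deck_exp normrM [X in _ * X]ger0_norm ?invr_ge0 ?(ltW card_deck_gt0)//.
by rewrite ler_wpM2r ?invr_ge0 ?(ltW card_deck_gt0)// ler_norm_sum.
Qed.

Lemma eq_deck_exp f h : f =1 h -> deck_exp f = deck_exp h.
Proof. by move=> fh; congr deck_exp; apply/funext. Qed.

(** Measurability with respect to what the player has seen after [i] cards. *)
Definition adapted i h := forall w w', take i w = take i w' -> h w = h w'.

Definition perm_deck (s : 'S_N) w : deck.
Proof.
exists [tuple tnth w (s j) | j < N].
apply/forallP => k; have /forallP/(_ k)/eqP wk := deckP w.
have /seq.permP -> : perm_eq [tuple tnth w (s j) | j < N] w.
  by apply/tuple_permP; exists s.
exact/eqP.
Defined.

Lemma perm_deck_inj s : injective (perm_deck s).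
Proof.
move=> w w' e; apply: val_inj; apply: eq_from_tnth => j.
have := congr1 (fun v : deck => tnth (cards v) ((s^-1)%g j)) e.
by rewrite /= !tnth_mktuple permKV.
Qed.

Lemma deck_exp_perm s f : deck_exp (fun w => f (perm_deck s w)) = deck_exp f.
Proof. by rewrite /deck_exp [in RHS](reindex_inj (@perm_deck_inj s)). Qed.

Lemma take_perm_deck (i j : 'I_N) w : (i <= j)%N ->
  take i (perm_deck (tperm i j) w) = take i w.
Proof.
move=> ij; have x0 := tnth w i.
apply: (@eq_from_nth _ x0); first by rewrite !size_take !size_tuple.
move=> k; rewrite size_take size_tuple ltn_ord => ki.
rewrite !nth_take//.
have kN := ltn_trans ki (ltn_ord i).
rewrite -[k]/(nat_of_ord (Ordinal kN)) -!tnth_nth tnth_mktuple tpermD//.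
  by rewrite -val_eqE /= gtn_eqF.
by rewrite -val_eqE /= gtn_eqF// (leq_trans ki).
Qed.

Definition mult i a w : nat := count_mem a (drop i w).
(** [onth] makes this total in [i]: it is false past the end of the deck. *)
Definition is_next i a w : bool := onth w i == Some a.

Lemma is_nextE (i : 'I_N) a w : is_next i a w = (tnth w i == a).
Proof.
rewrite /is_next onthE (nth_map (tnth w i)) ?size_tuple//.
by rewrite -tnth_nth.
Qed.

Lemma multS i a w : (i < N)%N -> mult i a w = (is_next i a w + mult i.+1 a w)%N.
Proof.
move=> iN; have x0 := tnth w (Ordinal iN).
rewrite -[i]/(nat_of_ord (Ordinal iN)) is_nextE /mult (tnth_nth x0).
by rewrite (drop_nth x0) ?size_tuple.
Qed.

Lemma mult0 a w : mult 0 a w = m.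
Proof. by rewrite /mult drop0; have /forallP/(_ a)/eqP := deckP w. Qed.

Lemma mult_take i a w : mult i a w = (m - count_mem a (take i w))%N.
Proof.
have := mult0 a w; rewrite {1}/mult drop0 -{1}(cat_take_drop i w) count_cat => e.
apply/eqP; rewrite -(eqn_add2l (count_mem a (take i w))) subnKC ?e//.
exact: leq_trans (leq_addr _ _) (eq_leq e).
Qed.

Lemma mult_le i a w : (mult i a w <= m)%N.
Proof. by rewrite mult_take leq_subr. Qed.

Lemma adapted_mult i (F : ('I_n -> nat) -> R) : adapted i (fun w => F (mult i ^~ w)).
Proof.
move=> w w' e; congr F; apply/funext => a.
by rewrite !mult_take e.
Qed.

Lemma sum_is_next i w (F : 'I_n -> R) (iN : (i < N)%N) :
  \sum_a (is_next i a w)%:R * F a = F (tnth w (Ordinal iN)).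
Proof.
rewrite (bigD1 (tnth w (Ordinal iN)))//= big1 ?addr0.
  by rewrite -[i]/(nat_of_ord (Ordinal iN)) is_nextE eqxx mul1r.
move=> a an; rewrite -[i]/(nat_of_ord (Ordinal iN)) is_nextE eq_sym.
by rewrite (negbTE an) mul0r.
Qed.

Lemma mult_sum i a w :
  mult i a w = (\sum_(j < N | (i <= j)%N) (tnth w j == a))%N.
Proof.
pose F j := (onth w j == Some a : nat).
transitivity (\sum_(i <= j < N) F j)%N; last first.
  rewrite big_geq_mkord; apply: eq_bigr => j _.
  by rewrite /F -[_ == _]/(is_next j a w) is_nextE.
move: {2}(N - i)%N (erefl (N - i)%N) => k; elim: k i => [|k IH] i ki.
  have Ni : (N <= i)%N by rewrite -subn_eq0 ki.
  by rewrite /mult drop_oversize ?size_tuple// big_geq.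
have iN : (i < N)%N by rewrite -subn_gt0 ki.
by rewrite multS// big_ltn// IH// subnS ki.
Qed.

(** Swapping position i with any j >= i preserves the law of the deck and its first i cards, so all
    remaining positions are alike; summing over j counts the copies of [a] left. This is the
    conditional law of the next card. *)
Lemma deck_exp_next i a h : (i < N)%N -> adapted i h ->
  (N - i)%:R * deck_exp (fun w => h w * (is_next i a w)%:R)
  = deck_exp (fun w => h w * (mult i a w)%:R).
Proof.
move=> iN ah; pose o := Ordinal iN.
have swap (j : 'I_N) : (i <= j)%N ->
    deck_exp (fun w => h w * (tnth w j == a)%:R) =
    deck_exp (fun w => h w * (is_next i a w)%:R).
  move=> ij; rewrite -(deck_exp_perm (tperm o j)); apply: eq_deck_exp => w.
  rewrite -[i]/(nat_of_ord o) is_nextE tnth_mktuple tpermR; congr (_ * _).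
  by apply: ah; rewrite -[i]/(nat_of_ord o) take_perm_deck.
transitivity (\sum_(j < N | (i <= j)%N) deck_exp (fun w => h w * (tnth w j == a)%:R)).
  under eq_bigr => j ij do rewrite swap//.
  set c := deck_exp _.
  transitivity (\sum_(i <= j < N) c); last by rewrite big_geq_mkord.
  by rewrite sumr_const_nat mulr_natl.
rewrite -deck_exp_sum; apply: eq_deck_exp => w.
by rewrite mult_sum natr_sum mulr_sumr.
Qed.
End DeckExpectation.

(** * Collisions among the remaining cards *)

Section Collisions.
Variables (R : realType) (m n r : nat).
Local Notation N := (m * n)%N.
Local Notation deck := (deck m n).
Local Notation E := (@deck_exp R m n).
Hypotheses (n0 : (0 < n)%N) (r1 : (1 <= r)%N) (rm : (r <= m)%N).
Implicit Types (w : deck) (h : deck -> R) (i : nat).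

Definition max_mult i w : nat := \max_a mult i a w.

(* [r`!] times the number of [r]-subsets of the remaining cards having a
   common type. *)
Definition collisions i w : R := \sum_a ((mult i a w) ^_ r)%:R.

(** The loss of [collisions] when a card with c copies left is removed. Over the c possible removals
    each ordered r-tuple is lost r times, whence [gap_mul]. *)
Let gap (c : nat) : R := (c ^_ r)%:R - (c.-1 ^_ r)%:R.

Let gap_mul c : c%:R * gap c = r%:R * (c ^_ r)%:R.
Proof.
case: c => [|c]; first by rewrite mul0r (ffact_small r1) mulr0.
rewrite /gap mulrBr -[in X in _ - X]natrM -ffactnS ffactnSr.
have [cr|rc] := ltnP c.+1 r; first by rewrite ffact_small// mul0n !mulr0 subr0.
by rewrite natrM natrB//; ring.
Qed.

Let gap_ge0 c : 0 <= gap c.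
Proof.
case: c => [|c]; first by rewrite /gap subrr.
have h := gap_mul c.+1.
by rewrite -(pmulr_rge0 _ (ltr0Sn R c)) h mulr_ge0.
Qed.

Lemma ffact_le_exp (a b : nat) : (a ^_ b <= a ^ b)%N.
Proof.
by elim: b => [//|b IH]; rewrite ffactnSr expnSr; apply: leq_mul => //; exact: leq_subr.
Qed.

Let K : R := (m ^ r)%:R.

Let gap_le i a w : gap (mult i a w) <= K.
Proof.
apply: (@le_trans _ _ ((mult i a w) ^_ r)%:R); first by rewrite /gap gerDl oppr_le0.
rewrite ler_nat (leq_trans (ffact_le_exp _ _))// leq_exp2r ?mult_le//.
Qed.

Lemma collisions_ge0 i w : 0 <= collisions i w.
Proof. by apply: sumr_ge0. Qed.

Lemma collisionsS i w : (i < N)%N ->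
  collisions i w - collisions i.+1 w = \sum_a (is_next i a w)%:R * gap (mult i a w).
Proof.
move=> iN; rewrite /collisions -sumrB; apply: eq_bigr => a _.
rewrite /gap multS//; case: (is_next i a w) => /=; first by rewrite add1n mul1r.
by rewrite add0n subrr mul0r.
Qed.

Lemma adapted_collisions i : adapted i (collisions i).
Proof. exact: (@adapted_mult R m n i (fun c => \sum_a (c a ^_ r)%:R)). Qed.

Lemma collisions_drift i h : (i < N)%N -> adapted i h ->
  (N - i)%:R * E (fun w => h w * (collisions i w - collisions i.+1 w)) =
  r%:R * E (fun w => h w * collisions i w).
Proof.
move=> iN ah.
transitivity (\sum_a (N - i)%:R * E (fun w => (h w * gap (mult i a w)) * (is_next i a w)%:R)).
  rewrite -mulr_sumr -deck_exp_sum; congr (_ * _); apply: eq_deck_exp => w.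
  by rewrite collisionsS// mulr_sumr; apply: eq_bigr => a _; ring.
have ah2 a : adapted i (fun w => h w * gap (mult i a w)).
  move=> w w' e; rewrite (ah _ _ e); congr (_ * _).
  exact: (@adapted_mult R m n i (fun c => gap (c a))) e.
under eq_bigr => a _ do rewrite deck_exp_next//.
rewrite -deck_exp_sum -deck_expZ; apply: eq_deck_exp => w.
rewrite /collisions !mulr_sumr; apply: eq_bigr => a _.
by rewrite -mulrA [gap _ * _]mulrC gap_mul; ring.
Qed.

(** Only the type of the revealed card changes, so there are no cross terms; one of the two factors
    [gap] is then bounded by K. *)
Lemma collisions_drift_sq i : (i < N)%N ->
  (N - i)%:R * E (fun w => (collisions i w - collisions i.+1 w) ^+ 2)
  <= r%:R * K * E (collisions i).
Proof.
move=> iN.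
have -> : E (fun w => (collisions i w - collisions i.+1 w) ^+ 2) =
    \sum_a E (fun w => gap (mult i a w) ^+ 2 * (is_next i a w)%:R).
  rewrite -deck_exp_sum; apply: eq_deck_exp => w.
  rewrite collisionsS// !(sum_is_next _ _ iN).
  rewrite -(sum_is_next w (fun a => gap (mult i a w) ^+ 2) iN).
  by apply: eq_bigr => a _; rewrite mulrC.
rewrite mulr_sumr.
have ah2 a : adapted i (fun w => gap (mult i a w) ^+ 2).
  move=> w w' e; congr (_ ^+ 2).
  exact: (@adapted_mult R m n i (fun c => gap (c a))) e.
under eq_bigr => a _ do rewrite deck_exp_next//.
rewrite -deck_exp_sum -deck_expZ; apply: deck_exp_le => w.
rewrite /collisions !mulr_sumr; apply: ler_sum => a _.
rewrite expr2 -mulrA [gap _ * _%:R]mulrC gap_mul mulrCA -mulrA ler_wpM2l//.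
by rewrite ler_wpM2r.
Qed.

Lemma collisions_meanS i : (i < N)%N ->
  (N - i)%:R * E (collisions i.+1) = ((N - i)%:R - r%:R) * E (collisions i).
Proof.
move=> iN; have a1 : @adapted R m n i (fun=> 1) by [].
have := collisions_drift iN a1.
have -> : E (fun w => 1 * (collisions i w - collisions i.+1 w)) = E (collisions i) - E (collisions i.+1).
  by rewrite -deck_expB; apply: eq_deck_exp => w; rewrite mul1r.
have -> : E (fun w => 1 * collisions i w) = E (collisions i).
  by apply: eq_deck_exp => w; rewrite mul1r.
by lra.
Qed.

Lemma collisions_mean i : (i <= N)%N ->
  E (collisions i) * (N ^_ r)%:R = n%:R * (m ^_ r)%:R * ((N - i) ^_ r)%:R.
Proof.
elim: i => [|i IH] iN.
  rewrite subn0; congr (_ * _).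
  have -> : collisions 0 = fun=> n%:R * (m ^_ r)%:R.
    apply/funext => w; rewrite /collisions.
    under eq_bigr do rewrite mult0.
    by rewrite sumr_const card_ord mulr_natl.
  exact: deck_exp_cst.
have j0 : (0 < N - i)%N by rewrite subn_gt0.
have j0' : (N - i)%:R != 0 :> R by rewrite pnatr_eq0 -lt0n.
apply: (mulfI j0'); rewrite mulrA collisions_meanS//.
rewrite -[X in X = _]mulrA IH 1?ltnW// subnS.
have [jr|rj] := ltnP (N - i) r.
  have jr' : ((N - i).-1 < r)%N by exact: leq_ltn_trans (leq_pred _) jr.
  by rewrite (ffact_small jr) (ffact_small jr') !mulr0.
have -> : (N - i)%:R * (n%:R * (m ^_ r)%:R * ((N - i).-1 ^_ r)%:R) =
   n%:R * (m ^_ r)%:R * ((N - i)%:R * ((N - i).-1 ^_ r)%:R) :> R by ring.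
rewrite -(natrM R (N - i)) -ffactnS ffactnSr natrM (natrB R rj).
by ring.
Qed.

Definition collisions_var i : R := E (fun w => collisions i w ^+ 2) - E (collisions i) ^+ 2.

Lemma collisions_varE i :
  E (fun w => (collisions i w - E (collisions i)) ^+ 2) = collisions_var i.
Proof.
set e := E (collisions i).
have -> : E (fun w => (collisions i w - e) ^+ 2) =
    E (fun w => 1 * (collisions i w ^+ 2) + 1 * (- (2 * e) * collisions i w + e ^+ 2 * 1)).
  by apply: eq_deck_exp => w; ring.
by rewrite !deck_exp_lin deck_exp_cst -/e /collisions_var -/e; ring.
Qed.

(** Induction along the deck: with j cards left, a step multiplies the mean by 1 - r / j and the
    second moment by 1 - 2 r / j, up to an addition of at most r K / j times the mean. The condition
    on i keeps the latter factor nonnegative. *)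
Lemma collisions_var_le i : (i + 2 * r <= N)%N -> collisions_var i <= K * E (collisions i).
Proof.
have K0 : 0 <= K by [].
have E0 k : 0 <= E (collisions k).
  rewrite -(deck_exp_cst m n (0 : R)); apply: deck_exp_le => w; exact: collisions_ge0.
elim: i => [|i IH] iN.
  rewrite -collisions_varE.
  have -> : collisions 0 = fun=> n%:R * (m ^_ r)%:R.
    apply/funext => w; rewrite /collisions.
    under eq_bigr do rewrite mult0.
    by rewrite sumr_const card_ord mulr_natl.
  by rewrite !deck_exp_cst subrr expr0n /= mulr_ge0.
have iN' : (i < N)%N by lia.
have {}IH : collisions_var i <= K * E (collisions i) by apply: IH; lia.
have d1 := collisions_drift iN' (@adapted_collisions i).
have d2 := collisions_drift_sq iN'.
have d3 := collisions_meanS iN'.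
have j2r : 2 * r%:R <= (N - i)%:R :> R by rewrite -natrM ler_nat; lia.
have jr0 : 0 <= (N - i)%:R - r%:R :> R by have : 0 <= r%:R :> R by []; lra.
have j0 : 0 < (N - i)%:R :> R by rewrite ltr0n; lia.
have eA : E (fun w => collisions i.+1 w ^+ 2) = E (fun w => collisions i w ^+ 2) +
   (-2 * E (fun w => collisions i w * (collisions i w - collisions i.+1 w)) +
   E (fun w => (collisions i w - collisions i.+1 w) ^+ 2)).
  by rewrite -deck_expZ -!deck_expD; apply: eq_deck_exp => w; ring.
have eB : E (fun w => collisions i w * collisions i w) = E (fun w => collisions i w ^+ 2).
  by apply: eq_deck_exp => w; rewrite expr2.
rewrite eB in d1; move: IH d1 d2 d3 eA (E0 i); rewrite /collisions_var.
set A := E (fun w => collisions i w ^+ 2); set A' := E (fun w => collisions i.+1 w ^+ 2).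
set B := E (fun w => _ * _); set D := E (fun w => _ ^+ 2).
set e := E (collisions i); set e' := E (collisions i.+1).
move: (N - i)%:R (r%:R : R) (ler0n R r) j2r jr0 j0 => j q q0 j2r jr0 j0 IH d1 d2 d3 eA e0.
rewrite -(ler_pM2l j0) -(ler_pM2l j0).
have -> : j * (j * (K * e')) = j * K * (j * e') by ring.
have -> : j * (j * (A' - e' ^+ 2)) = j * (j * A') - (j * e') ^+ 2 by ring.
have h1 : j * A' <= (j - 2 * q) * A + q * K * e by rewrite eA !mulrDr [j * (_ * B)]mulrCA d1; lra.
have h2 : (j - 2 * q) * A <= (j - 2 * q) * (K * e + e ^+ 2) by rewrite ler_wpM2l//; lra.
have h3 : j * (j * A') <= j * ((j - 2 * q) * (K * e + e ^+ 2) + q * K * e).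
  by rewrite ler_wpM2l ?(ltW j0)//; lra.
rewrite d3; apply: (@le_trans _ _ (j * ((j - 2 * q) * (K * e + e ^+ 2) + q * K * e) - ((j - q) * e) ^+ 2)).
  by rewrite lerD2r.
(* The two sides differ by exactly this square. *)
have : 0 <= (q * e) ^+ 2 by exact: sqr_ge0.
lra.
Qed.

(** * First and second moment bounds for the largest multiplicity *)

Lemma ffact_ratio_le (j M k : nat) : (j <= M)%N -> (j ^_ k * M ^ k <= M ^_ k * j ^ k)%N.
Proof.
move=> jM; elim: k => [//|k IH]; rewrite !ffactnSr !expnSr.
rewrite mulnACA [leqRHS]mulnACA leq_mul//.
have [jk|kj] := leqP j k; first by rewrite (eqP jk).
by rewrite !mulnBl [(M * j)%N]mulnC leq_sub2l// leq_mul2l jM orbT.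
Qed.

Lemma ffact_ge_exp (j k : nat) : (2 * k <= j)%N -> (j ^ k <= j ^_ k * 2 ^ k)%N.
Proof.
move=> kj; suff : forall l, (l <= k)%N -> (j ^ l <= j ^_ l * 2 ^ l)%N by apply.
elim=> [//|l IH] lk; rewrite ffactnSr !expnSr mulnACA leq_mul ?IH 1?ltnW//.
by lia.
Qed.

Lemma collisions_mean_le i : (i <= N)%N ->
  E (collisions i) <= (N - i)%:R ^+ r / n%:R ^+ r.-1.
Proof.
move=> iN.
have m0 : (0 < m)%N by exact: leq_trans rm.
have N0 : (0 < N)%N by rewrite muln_gt0 m0.
have rN : (r <= N)%N by rewrite (leq_trans rm)// leq_pmulr.
have F0 : 0 < (N ^_ r)%:R :> R by rewrite ltr0n ffact_gt0.
have n0' : 0 < n%:R :> R by rewrite ltr0n.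
rewrite -(ler_pM2r F0) collisions_mean// [leRHS]mulrAC ler_pdivlMr ?exprn_gt0//.
rewrite -!natrX -!natrM ler_nat.
have nm : (n ^ r.-1 * n = n ^ r)%N by rewrite -expnSr prednK.
apply: (@leq_trans (m ^ r * (N - i) ^_ r * n ^ r)%N).
  have -> : (n * m ^_ r * (N - i) ^_ r * n ^ r.-1 = m ^_ r * ((N - i) ^_ r * n ^ r))%N.
    by rewrite -nm; ring.
  by rewrite -mulnA leq_mul2r ffact_le_exp orbT.
have := ffact_ratio_le r (leq_subr i N); rewrite expnMn => h.
have -> : (m ^ r * (N - i) ^_ r * n ^ r = (N - i) ^_ r * (m ^ r * n ^ r))%N by ring.
by rewrite [leqRHS]mulnC.
Qed.

Lemma collisions_mean_ge i : (i + 2 * r <= N)%N ->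
  (N - i)%:R ^+ r / n%:R ^+ r.-1 / (2 * m%:R) ^+ r <= E (collisions i).
Proof.
move=> iN.
have m0 : (0 < m)%N by exact: leq_trans rm.
have rN : (r <= N)%N by rewrite (leq_trans rm)// leq_pmulr.
have F0 : 0 < (N ^_ r)%:R :> R by rewrite ltr0n ffact_gt0.
have n0' : 0 < n%:R :> R by rewrite ltr0n.
have m0' : 0 < m%:R :> R by rewrite ltr0n.
rewrite -(ler_pM2r F0) collisions_mean; last by lia.
rewrite mulrAC ler_pdivrMr ?exprn_gt0 ?mulr_gt0// mulrAC ler_pdivrMr ?exprn_gt0//.
rewrite -(natrM R 2 m) -!natrX -!natrM ler_nat.
have nm : (n ^ r.-1 * n = n ^ r)%N by rewrite -expnSr prednK.
apply: (@leq_trans ((N - i) ^_ r * 2 ^ r * (n ^ r * m ^ r))).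
  apply: leq_mul; first by apply: ffact_ge_exp; lia.
  by rewrite (leq_trans (ffact_le_exp _ _))// expnMn mulnC.
rewrite expnMn -nm; have : (0 < m ^_ r)%N by rewrite ffact_gt0.
move: (m ^_ r) => [//|k] _; rewrite mulnS.
by nia.
Qed.

(** First moment method: a type with r copies left makes [collisions] at least 1. *)
Lemma prob_max_mult_ge i : (i <= N)%N ->
  E (fun w => (r <= max_mult i w)%N%:R) <= (N - i)%:R ^+ r / n%:R ^+ r.-1.
Proof.
move=> iN; apply: le_trans (collisions_mean_le iN); apply: deck_exp_le => w.
have [rL|_] := leqP r (max_mult i w); last exact: collisions_ge0.
have card_n : (0 < #|'I_n|)%N by rewrite card_ord.
have [a ha] := @bigop.eq_bigmax _ (fun a => mult i a w) card_n; rewrite -/(max_mult i w) in ha.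
rewrite /collisions (bigD1 a)//= -[leLHS]addr0 lerD ?sumr_ge0//.
by rewrite ler_nat ffact_gt0 -ha.
Qed.

(** Second moment method: if no type has r copies left, [collisions] vanishes and is off its mean e
    by e. Chebyshev's inequality with variance at most K e gives K / e. *)
Lemma prob_max_mult_lt i : (i + 2 * r <= N)%N ->
  E (fun w => (max_mult i w < r)%N%:R)
  <= (m ^ r)%:R * (2 * m%:R) ^+ r / ((N - i)%:R ^+ r / n%:R ^+ r.-1).
Proof.
move=> iN.
have m0 : (0 < m)%N by exact: leq_trans rm.
have n0' : 0 < n%:R :> R by rewrite ltr0n.
have m0' : 0 < m%:R :> R by rewrite ltr0n.
have j0 : 0 < (N - i)%:R :> R by rewrite ltr0n; lia.
set rho := (N - i)%:R ^+ r / n%:R ^+ r.-1.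
have rho0 : 0 < rho by rewrite divr_gt0 ?exprn_gt0.
have m2 : 0 < (2 * m%:R) ^+ r :> R by rewrite exprn_gt0 ?mulr_gt0.
have ge := collisions_mean_ge iN; rewrite -/rho in ge.
have gd0 : 0 < rho / (2 * m%:R) ^+ r by rewrite divr_gt0.
have e0 : 0 < E (collisions i) by exact: lt_le_trans ge.
set e := E (collisions i) in ge e0 *.
have -> : (m ^ r)%:R * (2 * m%:R) ^+ r / rho = K / (rho / (2 * m%:R) ^+ r).
  by rewrite (invf_div rho) [in RHS]mulrA.
apply: (@le_trans _ _ (K / e)); last by rewrite ler_wpM2l ?ler0n// lef_pV2 ?posrE.
rewrite ler_pdivlMr// -(ler_pM2r e0) -mulrA -expr2.
apply: le_trans (collisions_var_le iN).
rewrite -collisions_varE -/e mulrC -deck_expZ; apply: deck_exp_le => w.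
have [Lr|_] := ltnP (max_mult i w) r; last by rewrite mulr0 sqr_ge0.
rewrite /collisions big1 ?sub0r ?sqrrN ?mulr1// => a _.
by rewrite ffact_small// (leq_ltn_trans _ Lr)// /max_mult (leq_bigmax a).
Qed.

End Collisions.

(** * Harmonic sums *)

Section HarmonicSums.
Variable R : realType.
Implicit Types (t : R) (N j : nat).

Lemma lnS_sub_ge N : (0 < N)%N -> N.+1%:R^-1 <= ln N.+1%:R - ln N%:R :> R.
Proof.
move=> N0; have n0 : 0 < N%:R :> R by rewrite ltr0n.
have n1 : 0 < N.+1%:R :> R by rewrite ltr0n.
have h : ln (N%:R / N.+1%:R) <= N%:R / N.+1%:R - 1 :> R.
  have x0 : 0 < N%:R / N.+1%:R :> R by rewrite divr_gt0.
  have : -1 < N%:R / N.+1%:R - 1 :> R by rewrite ltrBrDr addNr.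
  by move=> /le_ln1Dx; rewrite addrC subrK.
move: h; rewrite ln_div ?posrE//.
have -> : N%:R / N.+1%:R - 1 = - N.+1%:R^-1 :> R.
  by move: n1; rewrite -natr1 => n1; field; rewrite gt_eqF.
by rewrite lerNr opprB.
Qed.

Lemma lnS_sub_le N : (0 < N)%N -> ln N.+1%:R - ln N%:R <= N%:R^-1 :> R.
Proof.
move=> N0; have n0 : 0 < N%:R :> R by rewrite ltr0n.
have n1 : 0 < N.+1%:R :> R by rewrite ltr0n.
rewrite -ln_div ?posrE//.
have -> : N.+1%:R / N%:R = 1 + N%:R^-1 :> R.
  by rewrite -natr1; field; rewrite gt_eqF.
by apply: le_ln1Dx; rewrite (lt_trans _ (_ : 0 < _)) ?invr_gt0// ltrN10.
Qed.

Definition harm_tail t N : R := \sum_(j < N) (t <= j.+1%:R)%R%:R / j.+1%:R.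

Lemma harm_tail_le t N : 0 < t -> t <= N%:R -> harm_tail t N <= 1 + (ln N%:R - ln t).
Proof.
move=> t0; elim: N => [|N IH] tN; first by move: tN; rewrite leNgt t0.
rewrite /harm_tail big_ord_recr /= -/(harm_tail t N) tN mul1r.
have [tN'|Nt] := leP t N%:R.
  have N0 : (0 < N)%N by rewrite -(ltr0n R) (lt_le_trans t0).
  move: (IH tN') (lnS_sub_ge N0); move: N.+1%:R^-1 (ln N.+1%:R) => a b; lra.
have -> : harm_tail t N = 0.
  rewrite /harm_tail big1// => j _; rewrite leNgt (le_lt_trans _ Nt) ?mul0r//.
  by rewrite ler_nat.
rewrite add0r -[leLHS]addr0 lerD//; first by rewrite invf_le1 ?ler1n ?ltr0n.
by rewrite subr_ge0 ler_ln ?posrE// (lt_le_trans t0).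
Qed.

Lemma harm_tail_ge t N : 1 <= t -> t <= N.+1%:R -> ln N.+1%:R - ln t - 1 <= harm_tail t N.
Proof.
have hge0 k : 0 <= harm_tail t k by apply: sumr_ge0 => j _; rewrite divr_ge0.
move=> t1; have lnt0 : 0 <= ln t by rewrite ln_ge0.
elim: N => [|N IH] tN.
  by rewrite /harm_tail big_ord0 ln1; lra.
have h := lnS_sub_le (ltn0Sn N).
have [tN'|Nt] := leP t N.+1%:R.
  rewrite /harm_tail big_ord_recr /= -/(harm_tail t N) tN' mul1r.
  move: (IH tN') h; move: N.+1%:R^-1 (ln N.+1%:R) (ln N.+2%:R) => a b c; lra.
have lnN : ln N.+1%:R <= ln t by rewrite ler_ln ?posrE ?ltr0n ?ltW// (lt_le_trans ltr01).
have i1 : N.+1%:R^-1 <= 1 :> R by rewrite invf_le1 ?ler1n ?ltr0n.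
move: (hge0 N.+1) lnN i1 h; move: N.+1%:R^-1 (ln N.+1%:R) (ln N.+2%:R) => a b c; lra.
Qed.

(** The terms up to t sum to at most 1, the first term beyond t adds at most 1, and the later ones
    telescope against t / j, adding at most 1. *)
Lemma sum_min_le t N : 0 < t ->
  \sum_(j < N) Num.min (j.+1%:R / t) (t / j.+1%:R) / j.+1%:R <= 3.
Proof.
move=> t0.
suff : \sum_(j < N) Num.min (j.+1%:R / t) (t / j.+1%:R) / j.+1%:R
    <= if N%:R <= t then N%:R / t else 3 - t / N%:R.
  move=> /le_trans; apply; case: ifP => [h|/negbT]; last first.
    by rewrite -ltNge => h; rewrite gerDl oppr_le0 divr_ge0// ltW.
  by rewrite ler_pdivrMr//; lra.
elim: N => [|N IH]; first by rewrite big_ord0 (ltW t0) mul0r.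
rewrite big_ord_recr /=.
have n1 : 0 < N.+1%:R :> R by rewrite ltr0n.
have NS : N.+1%:R = N%:R + 1 :> R by rewrite -natr1.
case: ifPn => [h|]; last rewrite -ltNge => h.
  have h' : N%:R <= t by lra.
  rewrite h' in IH; apply: (@le_trans _ _ (N%:R / t + (N.+1%:R / t) / N.+1%:R)).
    by rewrite lerD// ler_wpM2r ?invr_ge0// ge_min lexx.
  by rewrite NS mulrAC divff ?gt_eqF -?NS// NS mulrDl.
apply: (@le_trans _ _ ((if N%:R <= t then N%:R / t else 3 - t / N%:R) + t / N.+1%:R / N.+1%:R)).
  by rewrite lerD// ler_wpM2r ?invr_ge0// ge_min lexx orbT.
have tn1 : t / N.+1%:R <= 1 by rewrite ler_pdivrMr// mul1r ltW.
case: ifPn => [h'|]; last rewrite -ltNge => h'.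
  have : N%:R / t <= 1 by rewrite ler_pdivrMr// mul1r.
  have : t / N.+1%:R / N.+1%:R <= 1.
    by rewrite ler_pdivrMr// mul1r (le_trans tn1)// ler1n.
  move: tn1; move: (N%:R / t) (t / N.+1%:R / N.+1%:R) => a b.
  by move: (t / N.+1%:R) => c; lra.
have n0 : 0 < N%:R :> R by rewrite (lt_trans t0).
suff : t / N.+1%:R / N.+1%:R <= t / N%:R - t / N.+1%:R.
  move: (t / N.+1%:R / N.+1%:R) => a.
  by move: (t / N.+1%:R) (t / N%:R) => b c; lra.
have -> : t / N%:R - t / N.+1%:R = t / N.+1%:R / N%:R.
  by move: n1; rewrite NS => n1'; field; rewrite !gt_eqF.
rewrite ler_wpM2l ?divr_ge0 ?(ltW t0) ?(ltW n1)// lef_pV2 ?posrE//.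
by rewrite ler_nat.
Qed.

Lemma sum_inv_sq_le N : \sum_(j < N) (j.+1%:R^-1) ^+ 2 <= 2 :> R.
Proof.
suff : \sum_(j < N.+1) (j.+1%:R^-1) ^+ 2 <= 2 - N.+1%:R^-1 :> R.
  rewrite big_ord_recr /=; have : 0 <= N.+1%:R^-1 :> R by rewrite invr_ge0.
  have : 0 <= (N.+1%:R^-1) ^+ 2 :> R by rewrite sqr_ge0.
  by move: (N.+1%:R^-1) => a; lra.
elim: N => [|N IH]; first by rewrite big_ord1 invr1 expr1n; lra.
rewrite big_ord_recr /= (le_trans (lerD IH (lexx _)))//.
have n1 : 0 < N.+1%:R :> R by rewrite ltr0n.
have n2 : 0 < N.+2%:R :> R by rewrite ltr0n.
suff : (N.+2%:R^-1) ^+ 2 <= N.+1%:R^-1 - N.+2%:R^-1 :> R.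
  by move: N.+1%:R^-1 N.+2%:R^-1 => a b; lra.
have -> : N.+1%:R^-1 - N.+2%:R^-1 = N.+2%:R^-1 * N.+1%:R^-1 :> R.
  by move: n2; rewrite -[N.+2%:R]natr1 => n2; field; rewrite !gt_eqF.
by rewrite expr2 ler_wpM2l ?invr_ge0// lef_pV2 ?posrE// ler_nat.
Qed.

End HarmonicSums.

(** * The greedy game *)

Section Game.
Variables (R : realType) (m n : nat) (g : strategy m n).
Hypothesis gP : greedy g.
Local Notation N := (m * n)%N.
Local Notation deck := (deck m n).
Local Notation E := (@deck_exp R m n).
Implicit Types (w : deck) (h : deck -> R) (i : nat).

(** Extended by [false] past the deck, so that [hits] satisfies a recursion on [nat]. *)
Definition hit i w : bool :=
  if insub i is Some o then g o (take i w) == tnth w o else false.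

Lemma hitE (o : 'I_N) w : hit o w = (g o (take o w) == tnth w o).
Proof. by rewrite /hit valK. Qed.

Definition hits i w : nat := \sum_(k < i) hit k w.

Lemma hitsS i w : hits i.+1 w = (hits i w + hit i w)%N.
Proof. by rewrite /hits big_ord_recr. Qed.

Lemma score_hits w : score g w = hits N w.
Proof.
rewrite /score /hits -sum1_card big_mkcond /=; apply: eq_bigr => o _.
rewrite hitE; set A := [set i | _].
have -> : (o \in in_set A) = (g o (take o w) == tnth w o).
  by apply/idP/idP => [/(@set_mem _ A)|h] //; exact: (@mem_set _ A).
by case: (_ == _).
Qed.


Lemma adapted_hits i w w' : take i w = take i w' -> hits i w = hits i w'.
Proof.
move=> e; rewrite /hits; apply: eq_bigr => k _; congr nat_of_bool.
rewrite /hit; case: insubP => // o _ ok.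
have ki : (o < i)%N by rewrite ok ltn_ord.
have ei (v : deck) : take o v = take o (take i v) by rewrite take_takel// ltnW.
rewrite -ok (ei w) (ei w') e; congr (_ == _).
have x0 := tnth w o.
by rewrite !(tnth_nth x0) -(nth_take x0 ki w) -(nth_take x0 ki w') e.
Qed.

(** The guess depends on revealed cards only, so [deck_exp_next] applies to each of its values; by
    greediness the guessed type has [max_mult] copies left. *)
Lemma hit_drift i h : (i < N)%N -> adapted i h ->
  (N - i)%:R * E (fun w => h w * (hit i w)%:R) = E (fun w => h w * (max_mult i w)%:R).
Proof.
move=> iN ah; pose o := Ordinal iN; pose G w := g o (take i w).
have -> : E (fun w => h w * (hit i w)%:R) =
    \sum_a E (fun w => (h w * (G w == a)%:R) * (is_next i a w)%:R).
  rewrite -deck_exp_sum; apply: eq_deck_exp => w.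
  rewrite (bigD1 (G w))//= big1 ?addr0; last first.
    by move=> a aG; rewrite eq_sym (negbTE aG) mulr0 mul0r.
  by rewrite eqxx mulr1 -[i]/(nat_of_ord o) hitE is_nextE eq_sym.
rewrite mulr_sumr.
have ah2 a : adapted i (fun w => h w * (G w == a)%:R).
  by move=> w w' e; rewrite (ah _ _ e) /G e.
under eq_bigr => a _ do rewrite deck_exp_next//.
rewrite -deck_exp_sum; apply: eq_deck_exp => w.
rewrite (bigD1 (G w))//= big1 ?addr0; last first.
  by move=> a aG; rewrite eq_sym (negbTE aG) mulr0 mul0r.
rewrite eqxx mulr1; congr (_ * _%:R); apply/eqP; rewrite eqn_leq.
rewrite /max_mult (leq_bigmax (G w)) /=; apply/bigmax_leqP => a _.
exact: (gP w o a).
Qed.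

Definition hit_prob i w : R := (max_mult i w)%:R / (N - i)%:R.

Lemma adapted_hit_prob i : adapted i (hit_prob i).
Proof. exact: (@adapted_mult R m n i (fun c => (\max_a c a)%:R / (N - i)%:R)). Qed.

Lemma hit_drift_prob i h : (i < N)%N -> adapted i h ->
  E (fun w => h w * (hit i w)%:R) = E (fun w => h w * hit_prob i w).
Proof.
move=> iN ah; have j0 : (N - i)%:R != 0 :> R by rewrite pnatr_eq0 -lt0n subn_gt0.
apply: (mulfI j0); rewrite hit_drift// -deck_expZ; apply: eq_deck_exp => w.
by rewrite /hit_prob; field.
Qed.

Lemma max_mult_le_size i w : (max_mult i w <= N - i)%N.
Proof.
apply/bigmax_leqP => a _; rewrite /mult (leq_trans (count_size _ _))//.
by rewrite size_drop size_tuple.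
Qed.

Lemma hit_prob01 i w : 0 <= hit_prob i w <= 1.
Proof.
rewrite /hit_prob divr_ge0//=.
have [->|j0] := posnP (N - i)%N; first by rewrite invr0 mulr0.
by rewrite ler_pdivrMr ?ltr0n// mul1r ler_nat max_mult_le_size.
Qed.

Lemma hits_mean : E (fun w => (hits N w)%:R) = \sum_(i < N) E (hit_prob i).
Proof.
transitivity (\sum_(i < N) E (fun w => (hit i w)%:R)).
  by rewrite -deck_exp_sum; apply: eq_deck_exp => w; rewrite /hits natr_sum.
apply: eq_bigr => i _; have a1 : @adapted R m n i (fun=> 1) by [].
have := hit_drift_prob (ltn_ord i) a1.
by under eq_deck_exp do rewrite mul1r; under [in RHS]eq_deck_exp do rewrite mul1r.
Qed.

Section Comparison.
Variables (q : nat -> R) (kappa : nat -> R) (f : nat -> R).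
Hypothesis fkappa : forall j s, `|bern_exp q j f s.+1 - bern_exp q j f s| <= kappa j.

(* Lindeberg replacement: the hits are traded one at a time, from the top of
   the deck on, for independent Bernoulli variables; [q j] is the parameter
   used when [j.+1] cards remain. *)
Lemma hits_bern_le :
  `|E (fun w => f (hits N w)) - bern_exp q N f 0| <=
  \sum_(i < N) E (fun w => `|hit_prob i w - q (N - i.+1)%N|) * kappa (N - i.+1)%N.
Proof.
pose T i := E (fun w => bern_exp q (N - i) f (hits i w)).
have -> : bern_exp q N f 0 = T 0%N.
  rewrite /T subn0 -[LHS](deck_exp_cst m n); apply: eq_deck_exp => w.
  by rewrite /hits big_ord0.
have -> : E (fun w => f (hits N w)) = T N by rewrite /T subnn.
suff : forall k, (k <= N)%N -> `|T k - T 0%N| <=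
  \sum_(i < k) E (fun w => `|hit_prob i w - q (N - i.+1)%N|) * kappa (N - i.+1)%N.
  exact.
elim=> [|k IH] kN; first by rewrite subrr normr0 big_ord0.
rewrite big_ord_recr /=.
have -> : T k.+1 - T 0%N = (T k - T 0%N) + (T k.+1 - T k) by ring.
apply: le_trans (ler_normD _ _) _; rewrite lerD ?IH 1?ltnW//.
set j := (N - k.+1)%N; have jE : (N - k)%N = j.+1 by rewrite /j; lia.
(* The effect of one more hit on the rest of the game. It is adapted, so against it the hit can be
   replaced by its conditional probability. *)
pose D w := bern_exp q j f (hits k w).+1 - bern_exp q j f (hits k w).
have aD : adapted k D by move=> w w' e; rewrite /D (adapted_hits e).
have -> : T k.+1 - T k = E (fun w => D w * (hit_prob k w - q j)).
  transitivity (E (fun w => D w * (hit k w)%:R) - E (fun w => D w * q j)).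
    rewrite /T -/j jE -!deck_expB; apply: eq_deck_exp => w.
    by rewrite hitsS /D /=; case: (hit k w); rewrite ?addn1 ?addn0 /=; ring.
  by rewrite hit_drift_prob// -deck_expB; apply: eq_deck_exp => w; ring.
apply: le_trans (deck_exp_norm _) _; rewrite mulrC -deck_expZ.
apply: deck_exp_le => w; rewrite normrM ler_wpM2r//.
exact: fkappa.
Qed.

End Comparison.

(** * Variance of the score through the compensated martingale *)

Definition compensated i w : R := \sum_(k < i) ((hit k w)%:R - hit_prob k w).

Lemma adapted_compensated i : adapted i (compensated i).
Proof.
elim: i => [|i IH] w w' e; first by rewrite /compensated !big_ord0.
have e' : take i w = take i w'.
  by rewrite -(take_takel w (leqnSn i)) -(take_takel w' (leqnSn i)) e.
rewrite /compensated !big_ord_recr /= -!/(compensated i _) (IH _ _ e') (adapted_hit_prob e').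
congr (_ + (_ - _)).
have := adapted_hits e; rewrite !hitsS (adapted_hits e') => /eqP.
by rewrite eqn_add2l => /eqP ->.
Qed.

(** Orthogonality of martingale increments. Since a hit equals its square, all terms containing it
    collect into an adapted factor [h] times the hit. *)
Lemma compensated_sq i : (i <= N)%N ->
  E (fun w => compensated i w ^+ 2) =
  \sum_(k < i) E (fun w => hit_prob k w * (1 - hit_prob k w)).
Proof.
elim: i => [|i IH] iN.
  rewrite big_ord0 -[RHS](deck_exp_cst m n); apply: eq_deck_exp => w.
  by rewrite /compensated big_ord0 expr0n.
rewrite big_ord_recr /= -IH 1?ltnW// -deck_expD.
pose h w := 2 * compensated i w - 2 * hit_prob i w + 1.
have ah : adapted i h.
  by move=> w w' e; rewrite /h (adapted_compensated e) (adapted_hit_prob e).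
transitivity (E (fun w => compensated i w ^+ 2
    + (- 2 * compensated i w * hit_prob i w + hit_prob i w ^+ 2)) + E (fun w => h w * (hit i w)%:R)).
  rewrite -deck_expD; apply: eq_deck_exp => w.
  rewrite /compensated big_ord_recr /= -/(compensated i w) /h.
  by case: (hit i w) => /=; ring.
rewrite hit_drift_prob// -deck_expD; apply: eq_deck_exp => w.
by rewrite /h; ring.
Qed.

(** The deviation of the score is the martingale plus the centered sum of p - q. The cross term is
    split by 2 |a b| <= d a^2 + b^2 / d, with d left free. *)
Lemma hits_variance (q : nat -> R) (d : R) : 0 < d ->
  `|E (fun w => ((hits N w)%:R - E (fun w => (hits N w)%:R)) ^+ 2)
    - \sum_(k < N) E (fun w => hit_prob k w * (1 - hit_prob k w))|
  <= d * (\sum_(k < N) E (fun w => hit_prob k w * (1 - hit_prob k w)))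
     + (1 + d^-1) * E (fun w => (\sum_(i < N) `|hit_prob i w - q (N - i.+1)%N|) ^+ 2).
Proof.
move=> d0; set mu := E (fun w => (hits N w)%:R); set v := \sum_(k < N) _.
pose D w := \sum_(i < N) `|hit_prob i w - q (N - i.+1)%N|.
rewrite -[E (fun w => (\sum_(i < N) _) ^+ 2)]/(E (fun w => D w ^+ 2)).
pose S w := \sum_(i < N) (hit_prob i w - q (N - i.+1)%N).
have muE : mu = E S + \sum_(i < N) q (N - i.+1)%N.
  rewrite /mu hits_mean /S deck_exp_sum -big_split /=; apply: eq_bigr => i _.
  by rewrite deck_expB deck_exp_cst subrK.
pose S' w := S w - E S.
have dev w : (hits N w)%:R - mu = compensated N w + S' w.
  rewrite muE /S' /S /compensated /hits natr_sum !sumrB; ring.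
have vE := compensated_sq (leqnn N); rewrite -/v in vE.
have S'2 : E (fun w => S' w ^+ 2) <= E (fun w => D w ^+ 2).
  have -> : E (fun w => S' w ^+ 2) = E (fun w => S w ^+ 2) - E S ^+ 2.
    have -> : E (fun w => S' w ^+ 2) = E (fun w => S w ^+ 2 + (- (2 * E S) * S w + E S ^+ 2)).
      by apply: eq_deck_exp => w; rewrite /S'; ring.
    by rewrite !deck_expD deck_expZ deck_exp_cst; ring.
  apply: (@le_trans _ _ (E (fun w => S w ^+ 2))).
    by rewrite gerDl oppr_le0 sqr_ge0.
  apply: deck_exp_le => w; rewrite -(real_normK (num_real (S w))).
  have Sle : `|S w| <= D w by exact: ler_norm_sum.
  by rewrite ler_sqr ?nnegrE// (le_trans _ Sle).
have -> : E (fun w => ((hits N w)%:R - mu) ^+ 2) =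
    v + E (fun w => 2 * compensated N w * S' w + S' w ^+ 2).
  by rewrite -vE -deck_expD; apply: eq_deck_exp => w; rewrite dev; ring.
rewrite addrAC subrr add0r; apply: le_trans (deck_exp_norm _) _.
apply: (@le_trans _ _ (d * v + (1 + d^-1) * E (fun w => S' w ^+ 2))); last first.
  by rewrite lerD2l ler_wpM2l// addr_ge0// invr_ge0 ltW.
rewrite -vE -deck_exp_lin; apply: deck_exp_le => w.
set a := compensated N w; set b := S' w.
apply: le_trans (ler_normD _ _) _; rewrite [X in _ + X]ger0_norm ?sqr_ge0//.
suff : `|2 * a * b| <= d * a ^+ 2 + d^-1 * b ^+ 2 by lra.
have h1 : 0 <= d^-1 * (d * a - b) ^+ 2 by rewrite mulr_ge0 ?sqr_ge0// invr_ge0 ltW.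
have h2 : 0 <= d^-1 * (d * a + b) ^+ 2 by rewrite mulr_ge0 ?sqr_ge0// invr_ge0 ltW.
have e1 : d^-1 * (d * a - b) ^+ 2 = d * a ^+ 2 + d^-1 * b ^+ 2 - 2 * a * b.
  by field; rewrite gt_eqF.
have e2 : d^-1 * (d * a + b) ^+ 2 = d * a ^+ 2 + d^-1 * b ^+ 2 + 2 * a * b.
  by field; rewrite gt_eqF.
rewrite e1 in h1; rewrite e2 in h2; rewrite ler_norml.
by move: h1 h2; move: (d * a ^+ 2 + d^-1 * b ^+ 2) (2 * a * b) => u v'; lra.
Qed.

End Game.

(** * Expectations as finite averages *)

Section Interface.
Variables (R : realType) (m n : nat).
Local Notation deck := (deck m n).
Local Notation E := (@deck_exp R m n).
Local Notation P := (shuffle R m n).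

Lemma measurable_deck (A : set deck) : measurable A.
Proof. by []. Qed.

Lemma shuffle1 (w : deck) : P [set w] = (#|{: deck}|%:R^-1)%:E.
Proof.
rewrite /shuffle /mscale /= /counting asboolT; last exact: finite_finset.
by rewrite fset_set1 finmap.cardfs1 mule1.
Qed.

(** A function on decks is a finite combination of indicators of points; nonnegativity, which the
    score and squared deviations satisfy, allows termwise integration. *)
Lemma expectation_shuffle (f : deck -> R) : (forall w, 0 <= f w) ->
  ('E_P[f] = (E f)%:E)%E.
Proof.
move=> f0; rewrite unlock.
transitivity (\int[P]_w (\sum_(v : deck) (f v)%:E * (\1_[set v] w)%:E))%E.
  apply: eq_integral => w _; rewrite (bigD1 w)//= big1 ?adde0.
    by rewrite indicE mem_set// mule1.
  by move=> v vw; rewrite indicE memNset ?mule0//= => /eqP; rewrite eq_sym (negbTE vw).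
rewrite ge0_integral_sum//; last by move=> v w _; rewrite mule_ge0// lee_fin.
rewrite /deck_exp mulr_suml -sumEFin; apply: eq_bigr => v _.
under eq_integral do rewrite -EFinM.
rewrite (integralZl_indic _ (fun=> [set v]))//.
  by rewrite integral_indic// setIT [X in (_ * X)%E](shuffle1 v) -EFinM.
by rewrite ltNge f0.
Qed.

Lemma shuffleE (A : set deck) : P A = (E (fun w => (w \in A)%:R))%:E.
Proof.
rewrite -expectation_indic//.
by rewrite expectation_shuffle.
Qed.

Variable g : strategy m n.

Lemma mean_scoreE : mean_score R g = E (scoreR R g).
Proof. by rewrite /mean_score expectation_shuffle. Qed.

Lemma var_scoreE : var_score R g = E (fun w => (scoreR R g w - mean_score R g) ^+ 2).
Proof.
rewrite /var_score /variance unlock.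
have -> : ((scoreR R g \- cst (fine 'E_P[scoreR R g])) * (scoreR R g \- cst (fine 'E_P[scoreR R g])))%R
   = (fun w => (scoreR R g w - mean_score R g) ^+ 2).
  by apply/funext => w; rewrite expr2.
by rewrite expectation_shuffle// => w; exact: sqr_ge0.
Qed.

Lemma std_score_cdfE (x : R) : std_score_cdf g x =
  (E (fun w => ((scoreR R g w - mean_score R g) / std_score R g <= x)%R%:R))%:E.
Proof.
rewrite /std_score_cdf shuffleE; congr (_%:E); apply: eq_deck_exp => w.
congr ((nat_of_bool _)%:R); apply/idP/idP; [exact: set_mem|exact: mem_set].
Qed.

End Interface.

(** * The largest multiplicity *)

Section Levels.
Variables (R : realType) (m n : nat).
Hypothesis m1 : (1 <= m)%N.
Local Notation N := (m * n)%N.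
Local Notation deck := (deck m n).
Local Notation E := (@deck_exp R m n).
Local Notation l := (ln n%:R : R).
(** Ensures that n^(1/2) >= 2 m and that, beyond n^(1/4) cards, the Bernoulli variance is at least
    (ln n) / 16. *)
Hypothesis n_large : 8 * (ln (2 * m%:R) + 1) <= l.
Implicit Types (r i j k : nat) (w : deck).

Let m0 : 0 < m%:R :> R. Proof. by rewrite ltr0n. Qed.
Let m1' : 1 <= m%:R :> R. Proof. by rewrite ler1n. Qed.

Let ln2m_ge0 : 0 <= ln (2 * m%:R) :> R.
Proof. by rewrite ln_ge0//; have := m1'; lra. Qed.

Lemma level_l8 : 8 <= l.
Proof. by move: n_large ln2m_ge0; move: (ln (2 * _)) (ln n%:R) => a b; lra. Qed.

Lemma level_n0 : (0 < n)%N.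
Proof.
by case: n level_l8 => [|//]; rewrite ln0// leNgt ltr0n.
Qed.

Let n0 : 0 < n%:R :> R. Proof. by rewrite ltr0n level_n0. Qed.

(* [n ^ (1 - 1/r)], the number of remaining cards around which some type starts
   to occur [r] times among them. *)
Definition threshold r : R := expR (l * (1 - r%:R^-1)).

Definition level j : R := \sum_(1 <= r < m.+1) (threshold r <= j%:R)%R%:R.

(** The index r = 1 is left out: as long as a card remains, some type surely occurs, and no error
    arises. *)
Definition proximity j : R :=
  \sum_(2 <= r < m.+1) Num.min (j%:R / threshold r) (threshold r / j%:R).

(** Index k stands for k + 1 cards left, so the last k cards correspond to the first k Bernoulli
    variables. *)
Definition level_prob k : R := level k.+1 / k.+1%:R.

Lemma threshold_gt0 r : 0 < threshold r. Proof. exact: expR_gt0. Qed.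

Lemma ln_threshold r : ln (threshold r) = l * (1 - r%:R^-1).
Proof. by rewrite /threshold expRK. Qed.

Lemma threshold1 : threshold 1 = 1.
Proof. by rewrite /threshold invr1 subrr mulr0 expR0. Qed.

Lemma threshold_ge1 r : (0 < r)%N -> 1 <= threshold r.
Proof.
move=> r0; rewrite -[leLHS]expR0 ler_expR mulr_ge0//; first by have := level_l8; lra.
by rewrite subr_ge0 invf_le1 ?ltr0n// ler1n.
Qed.

Lemma threshold_le r : threshold r <= n%:R.
Proof.
rewrite -[leRHS]lnK ?posrE// ler_expR ler_piMr//.
  by have := level_l8; lra.
Qed.

Lemma threshold_leN r : threshold r <= N%:R.
Proof.
apply: le_trans (threshold_le r) _.
by rewrite ler_nat leq_pmull.
Qed.

Lemma threshold_exp r : (0 < r)%N -> threshold r ^+ r = n%:R ^+ r.-1.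
Proof.
move=> r0; rewrite /threshold -expRM_natl -[in RHS](lnK (x := n%:R)) ?posrE//.
rewrite -expRM_natl; congr expR.
have r0' : r%:R != 0 :> R by rewrite pnatr_eq0 -lt0n.
have -> : r.-1%:R = r%:R - 1 :> R by rewrite -subn1 natrB.
by field.
Qed.

Lemma threshold_ge_sqrt r : (2 <= r)%N -> expR (l / 2) <= threshold r.
Proof.
move=> r2; rewrite ler_expR ler_wpM2l//; first by have := level_l8; lra.
have : r%:R^-1 <= 2^-1 :> R by rewrite lef_pV2 ?posrE ?ltr0n ?ler_nat// (leq_trans _ r2).
by move: (r%:R^-1) => a; lra.
Qed.

Lemma threshold_ge2m r : (2 <= r)%N -> 2 * m%:R <= threshold r.
Proof.
move=> r2; apply: le_trans (threshold_ge_sqrt r2).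
rewrite -[leLHS]lnK ?posrE ?mulr_gt0// ler_expR.
by have := n_large; have := ln2m_ge0; lra.
Qed.

Lemma levelE j : (0 < j)%N ->
  level j = 1 + \sum_(2 <= r < m.+1) (threshold r <= j%:R)%R%:R.
Proof.
by move=> j0; rewrite /level big_ltn ?ltnS// threshold1 ler1n j0.
Qed.

Lemma level_ge1 j : (0 < j)%N -> 1 <= level j.
Proof. by move=> j0; rewrite levelE// lerDl sumr_ge0. Qed.

Lemma level_le_m j : level j <= m%:R.
Proof.
apply: (@le_trans _ _ (\sum_(1 <= r < m.+1) 1)).
  by apply: ler_sum => r _; case: (threshold r <= _).
by rewrite sumr_const_nat subn1.
Qed.

(** Makes [level_prob] a probability. With fewer than m cards only r = 1 counts, the other
    thresholds being at least 2 m. *)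
Lemma level_le j : (0 < j)%N -> level j <= j%:R.
Proof.
move=> j0; have [mj|jm] := leqP m j.
  by rewrite (le_trans (level_le_m j))// ler_nat.
rewrite levelE// big_nat_cond big1 ?addr0 ?ler1n// => r /andP[/andP[r2 _] _].
rewrite leNgt (lt_le_trans _ (threshold_ge2m r2))//.
by apply: (@lt_trans _ _ m%:R); [rewrite ltr_nat|have := m0; lra].
Qed.

Lemma level_prob01 k : 0 <= level_prob k <= 1.
Proof.
rewrite /level_prob divr_ge0//=; last by rewrite (le_trans ler01)// level_ge1.
by rewrite ler_pdivrMr ?ltr0n// mul1r level_le.
Qed.

Lemma proximity_term j r : (0 < j)%N ->
  0 <= Num.min (j%:R / threshold r) (threshold r / j%:R) <= 1.
Proof.
move=> j0; have j0' : 0 < j%:R :> R by rewrite ltr0n.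
have t0 := threshold_gt0 r.
rewrite le_min !divr_ge0 ?(ltW j0') ?(ltW t0)//= ge_min.
rewrite !ler_pdivrMr// !mul1r.
by case: (leP j%:R (threshold r)) => // /ltW ->; rewrite orbT.
Qed.

Lemma proximity_ge0 j : (0 < j)%N -> 0 <= proximity j.
Proof. by move=> j0; apply: sumr_ge0 => r _; have /andP[] := proximity_term r j0. Qed.

Lemma proximity_le_m j : (0 < j)%N -> proximity j <= m%:R.
Proof.
move=> j0; apply: (@le_trans _ _ (\sum_(2 <= r < m.+1) 1)).
  by apply: ler_sum => r _; have /andP[] := proximity_term r j0.
by rewrite sumr_const_nat ler_nat; lia.
Qed.

Lemma sum_proximity k : \sum_(j < k) proximity j.+1 / j.+1%:R <= 3 * m%:R.
Proof.
rewrite /proximity; under eq_bigr do rewrite mulr_suml.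
rewrite exchange_big /=; apply: (@le_trans _ _ (\sum_(2 <= r < m.+1) 3)).
  by apply: ler_sum => r _; exact: sum_min_le (threshold_gt0 r).
by rewrite sumr_const_nat -[_ *+ (_ - _)]mulr_natr ler_wpM2l// ler_nat; lia.
Qed.

(** Every threshold with r >= 2 is at least n^(1/2), a factor n^(1/4) away from such j. *)
Lemma proximity_low j : (0 < j)%N -> j%:R <= expR (l / 4) -> proximity j <= m%:R * expR (- (l / 4)).
Proof.
move=> j0 jl; apply: (@le_trans _ _ (\sum_(2 <= r < m.+1) expR (- (l / 4)))); last first.
  by rewrite sumr_const_nat -[_ *+ (_ - _)]mulr_natr mulrC ler_wpM2r ?expR_ge0// ler_nat; lia.
rewrite /proximity big_nat_cond [leRHS]big_nat_cond; apply: ler_sum => r /andP[/andP[r2 _] _].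
rewrite ge_min ler_pdivrMr ?threshold_gt0//.
apply/orP; left; apply: (le_trans jl).
have -> : expR (l / 4) = expR (- (l / 4)) * expR (l / 2) by rewrite -expRD; congr expR; lra.
by rewrite ler_wpM2l ?expR_ge0 ?threshold_ge_sqrt.
Qed.

(** The constant of [prob_max_mult_lt] at the largest value r = m. *)
Definition level_cst : R := (m ^ m)%:R * (2 * m%:R) ^+ m.

Lemma level_cst_ge1 : 1 <= level_cst.
Proof.
rewrite /level_cst -[leLHS]mulr1 ler_pM ?ler1n ?expn_gt0 ?m1//.
by rewrite exprn_ege1//; have := m1'; lra.
Qed.

Lemma max_mult_sum i w :
  (max_mult i w)%:R = \sum_(1 <= r < m.+1) (r <= max_mult i w)%N%:R :> R.
Proof.
have aux k : forall a, (a <= k)%N -> a%:R = \sum_(1 <= r < k.+1) (r <= a)%N%:R :> R.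
  elim: k => [|k IH] a; first by rewrite leqn0 => /eqP ->; rewrite big_geq.
  rewrite big_nat_recr//= => ak; have [ka|ka] := leqP k.+1 a; last by rewrite addr0 IH.
  have -> : a = k.+1 by apply/eqP; rewrite eqn_leq ak.
  rewrite -natr1; congr (_ + _); rewrite (IH k)//; apply: eq_big_nat => r /andP[_].
  by rewrite ltnS => rk; rewrite rk (leqW rk).
by apply: aux; apply/bigmax_leqP => a _; exact: mult_le.
Qed.

Lemma expr_le_sq (x : R) r : (2 <= r)%N -> 0 <= x <= 1 -> x ^+ r <= x ^+ 2.
Proof. by move=> r2 /andP[x0 x1]; rewrite ler_wiXn2l. Qed.

(** Above the threshold the second moment bound applies, below it the first; both give the ratio to
    the power r, of which only the square is kept. *)
Lemma level_dev_term i r : (i < N)%N -> (2 <= r <= m)%N ->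
  E (fun w => `|(r <= max_mult i w)%N%:R - (threshold r <= (N - i)%:R)%R%:R|) <=
  level_cst * Num.min ((N - i)%:R / threshold r) (threshold r / (N - i)%:R) ^+ 2.
Proof.
move=> iN /andP[r2 rm]; set j := (N - i)%N.
have j0 : (0 < j)%N by rewrite subn_gt0.
have j0' : 0 < j%:R :> R by rewrite ltr0n.
have r1 : (0 < r)%N by exact: leq_trans r2.
have t0 := threshold_gt0 r.
have [tj|jt] := leP (threshold r) j%:R.
  have -> : Num.min (j%:R / threshold r) (threshold r / j%:R) = threshold r / j%:R.
    apply/min_idPr; apply: (@le_trans _ _ 1); first by rewrite ler_pdivrMr ?mul1r.
    by rewrite ler_pdivlMr ?mul1r.
  have i2r : (i + 2 * r <= N)%N.
    have : (2 * r <= j)%N; last by rewrite /j; lia.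
    rewrite -(ler_nat R) natrM (le_trans _ (le_trans (threshold_ge2m r2) tj))//.
    by rewrite ler_wpM2l// ler_nat.
  apply: le_trans (le_trans (prob_max_mult_lt R level_n0 r1 rm i2r) _).
    apply: deck_exp_le => w; have [h|h] := leqP r (max_mult i w); rewrite /=.
      by rewrite subrr normr0.
    by rewrite sub0r normrN normr1.
  rewrite -/j -threshold_exp// -expr_div_n -exprVn invf_div.
  have x01 : 0 <= threshold r / j%:R <= 1.
    by rewrite divr_ge0 ?(ltW t0) ?(ltW j0')//= ler_pdivrMr ?mul1r.
  rewrite ler_pM ?(expr_le_sq r2 x01) ?mulr_ge0 ?exprn_ge0 ?divr_ge0 ?(ltW m0) ?(ltW t0)//.
  rewrite /level_cst ler_pM ?exprn_ge0 ?mulr_ge0 ?(ltW m0)//.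
    by rewrite ler_nat leq_pexp2l.
  by rewrite ler_weXn2l//; have := m1'; lra.
have -> : Num.min (j%:R / threshold r) (threshold r / j%:R) = j%:R / threshold r.
  apply/min_idPl; apply: (@le_trans _ _ 1); first by rewrite ler_pdivrMr ?mul1r ?ltW.
  by rewrite ler_pdivlMr ?mul1r ?ltW.
apply: le_trans (le_trans (prob_max_mult_ge R level_n0 r1 rm (ltnW iN)) _).
  apply: deck_exp_le => w; rewrite subr0.
  by case: (r <= _)%N; rewrite /= ?normr1 ?normr0.
rewrite -/j -threshold_exp// -expr_div_n.
have x01 : 0 <= j%:R / threshold r <= 1.
  by rewrite divr_ge0 ?(ltW t0) ?(ltW j0')//= ler_pdivrMr ?mul1r ?ltW.
apply: (le_trans (expr_le_sq r2 x01)); rewrite -[leLHS]mul1r ler_wpM2r ?sqr_ge0//.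
exact: level_cst_ge1.
Qed.

Lemma sum_sqr_le (I : Type) (s : seq I) (Q : pred I) (x : I -> R) :
  (forall c, Q c -> 0 <= x c) -> \sum_(c <- s | Q c) x c ^+ 2 <= (\sum_(c <- s | Q c) x c) ^+ 2.
Proof.
move=> x0; elim: s => [|a s IH]; first by rewrite !big_nil expr0n.
rewrite !big_cons; case: ifP => // Qa; rewrite sqrrD.
have := x0 a Qa; have : 0 <= \sum_(c <- s | Q c) x c by exact: sumr_ge0.
move: IH; move: (\sum_(c <- s | Q c) x c) (\sum_(c <- s | Q c) x c ^+ 2) (x a) => u v y.
by move=> vu u0 y0; have : 0 <= y * u by [exact: mulr_ge0]; rewrite mulr2n; lra.
Qed.

Lemma max_mult_gt0 i w : (i < N)%N -> (0 < max_mult i w)%N.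
Proof.
move=> iN; apply: leq_trans (leq_bigmax (tnth w (Ordinal iN))).
by rewrite multS// -[i]/(nat_of_ord (Ordinal iN)) is_nextE eqxx.
Qed.

Lemma level_dev i : (i < N)%N ->
  E (fun w => `|(max_mult i w)%:R - level (N - i)|) <= level_cst * proximity (N - i) ^+ 2.
Proof.
move=> iN; have j0 : (0 < N - i)%N by rewrite subn_gt0.
apply: (@le_trans _ _ (\sum_(2 <= r < m.+1)
   E (fun w => `|(r <= max_mult i w)%N%:R - (threshold r <= (N - i)%:R)%R%:R|))).
  rewrite -deck_exp_sum; apply: deck_exp_le => w.
  rewrite levelE// max_mult_sum big_ltn ?ltnS// max_mult_gt0//=.
  by rewrite opprD addrACA subrr add0r -sumrB ler_norm_sum.
apply: (@le_trans _ _ (\sum_(2 <= r < m.+1) level_cst *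
   Num.min ((N - i)%:R / threshold r) (threshold r / (N - i)%:R) ^+ 2)).
  rewrite big_nat_cond [leRHS]big_nat_cond; apply: ler_sum => r /andP[rI _].
  exact: level_dev_term.
rewrite -mulr_sumr ler_wpM2l//; first by rewrite (le_trans ler01)// level_cst_ge1.
by apply: sum_sqr_le => r _; have /andP[] := proximity_term r j0.
Qed.

End Levels.

(** * Comparison of the score with a Bernoulli sum *)

Section Estimates.
Variables (R : realType) (m n : nat).
Hypothesis m1 : (1 <= m)%N.
Local Notation N := (m * n)%N.
Local Notation deck := (deck m n).
Local Notation E := (@deck_exp R m n).
Local Notation l := (ln n%:R : R).
Hypothesis n_large : 8 * (ln (2 * m%:R) + 1) <= l.
Local Notation q := (level_prob R m n).
Local Notation prox := (proximity R m n).
Local Notation lcst := (level_cst R m).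
Local Notation p := (@hit_prob R m n).
Implicit Types (r i j k : nat) (w : deck).

Let m0 : 0 < m%:R :> R. Proof. by rewrite ltr0n. Qed.
Let m1' : 1 <= m%:R :> R. Proof. by rewrite ler1n. Qed.
Let c0 : 0 <= lcst. Proof. by rewrite (le_trans ler01) ?level_cst_ge1. Qed.
Let l8 : 8 <= l. Proof. exact: level_l8 n_large. Qed.
Let q01 k : 0 <= q k <= 1. Proof. exact: level_prob01. Qed.
Let sql0 : 0 < Num.sqrt l. Proof. by rewrite sqrtr_gt0; have := l8; lra. Qed.
Let sqlE : Num.sqrt l ^+ 2 = l. Proof. by rewrite sqr_sqrtr//; have := l8; lra. Qed.

Let subnS' i : (i < N)%N -> (N - i.+1).+1 = (N - i)%N.
Proof. by lia. Qed.

Lemma hit_prob_dev i w : (i < N)%N -> `|p i w - q (N - i.+1)%N| =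
  `|(max_mult i w)%:R - level R m n (N - i)| / (N - i)%:R.
Proof.
move=> iN; rewrite /hit_prob /level_prob subnS'// -mulrBl normrM.
by rewrite [X in _ * X]ger0_norm// invr_ge0.
Qed.

Lemma hit_prob_dev_mean i : (i < N)%N -> E (fun w => `|p i w - q (N - i.+1)%N|) <=
  lcst * prox (N - i) ^+ 2 / (N - i)%:R.
Proof.
move=> iN; have -> : E (fun w => `|p i w - q (N - i.+1)%N|) =
   (N - i)%:R^-1 * E (fun w => `|(max_mult i w)%:R - level R m n (N - i)|).
  by rewrite -deck_expZ; apply: eq_deck_exp => w; rewrite hit_prob_dev// mulrC.
by rewrite mulrC ler_wpM2r ?invr_ge0// level_dev.
Qed.

Lemma sum_ord_rev (F : nat -> R) k : \sum_(i < k) F (k - i.+1)%N = \sum_(i < k) F i.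
Proof. by rewrite [RHS](reindex_inj rev_ord_inj). Qed.

(** One factor of the squared proximity is absorbed by [kappa]; the other is summed against 1 /
    j. *)
Lemma sum_hit_prob_dev (kappa : nat -> R) (c1 : R) :
  (forall k, 0 <= kappa k) -> (forall k, prox k.+1 * kappa k <= c1) ->
  \sum_(i < N) E (fun w => `|p i w - q (N - i.+1)%N|) * kappa (N - i.+1)%N
  <= lcst * c1 * (3 * m%:R).
Proof.
move=> k0 kc.
have c10 : 0 <= c1 by apply: le_trans (kc 0%N); rewrite mulr_ge0// proximity_ge0.
apply: (@le_trans _ _ (\sum_(i < N) lcst * c1 * (prox (N - i.+1).+1 / (N - i.+1).+1%:R))).
  apply: ler_sum => i _; have iN := ltn_ord i.
  apply: (@le_trans _ _ (lcst * prox (N - i) ^+ 2 / (N - i)%:R * kappa (N - i.+1)%N)).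
    by rewrite ler_wpM2r// hit_prob_dev_mean.
  rewrite subnS'//; have := kc (N - i.+1)%N; rewrite subnS'// => h.
  have pr0 : 0 <= prox (N - i) by rewrite proximity_ge0// subn_gt0.
  have -> : lcst * prox (N - i) ^+ 2 / (N - i)%:R * kappa (N - i.+1)%N =
    lcst * (prox (N - i) / (N - i)%:R) * (prox (N - i) * kappa (N - i.+1)%N) by ring.
  have -> : lcst * c1 * (prox (N - i) / (N - i)%:R) = lcst * (prox (N - i) / (N - i)%:R) * c1 by ring.
  by rewrite ler_wpM2l// mulr_ge0// divr_ge0.
rewrite -mulr_sumr (sum_ord_rev (fun k => prox k.+1 / k.+1%:R)).
by rewrite ler_wpM2l ?mulr_ge0// sum_proximity.
Qed.

Lemma sum_hit_prob_dev1 :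
  \sum_(i < N) E (fun w => `|p i w - q (N - i.+1)%N|) <= lcst * m%:R * (3 * m%:R).
Proof.
have := @sum_hit_prob_dev (fun=> 1) m%:R (fun=> ler01).
under eq_bigr do rewrite mulr1; apply => k.
by rewrite mulr1 proximity_le_m.
Qed.

(** In the product for positions i and k, the deviation with the larger proximity is bounded by m /
    j and the other in mean by its squared proximity, which is at most the product of both. The
    double sum then factorises. *)
Lemma sum_hit_prob_dev_sq :
  E (fun w => (\sum_(i < N) `|p i w - q (N - i.+1)%N|) ^+ 2) <= lcst * m%:R * (3 * m%:R) ^+ 2.
Proof.
pose a i w := `|p i w - q (N - i.+1)%N|.
pose b i := prox (N - i.+1).+1 / (N - i.+1).+1%:R.
pose j i : R := (N - i)%:R.
have dev_le i w : `|(max_mult i w)%:R - level R m n (N - i)| <= m%:R.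
  have : (max_mult i w)%:R <= m%:R :> R.
    by rewrite ler_nat; apply/bigmax_leqP => c _; exact: mult_le.
  have := level_le_m R m n (N - i).
  have : 0 <= level R m n (N - i) by apply: sumr_ge0.
  have : 0 <= (max_mult i w)%:R :> R by [].
  by rewrite ler_norml; lra.
have half i k : (i < N)%N -> (k < N)%N -> prox (N - i) <= prox (N - k) ->
    E (fun w => a i w * a k w) <= lcst * m%:R * (b i * b k).
  move=> iN kN ik; have jk0 : 0 < j k by rewrite ltr0n subn_gt0.
  have pi0 : 0 <= prox (N - i) by rewrite proximity_ge0// subn_gt0.
  apply: (@le_trans _ _ (m%:R / j k * E (a i))).
    rewrite -deck_expZ; apply: deck_exp_le => w; rewrite mulrC ler_wpM2r ?normr_ge0//.
    by rewrite /a hit_prob_dev// ler_wpM2r ?invr_ge0.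
  apply: (@le_trans _ _ (m%:R / j k * (lcst * prox (N - i) ^+ 2 / j i))).
    by rewrite ler_wpM2l ?hit_prob_dev_mean// divr_ge0 ?ler0n.
  rewrite /b !subnS'// -/(j i) -/(j k).
  have -> : m%:R / j k * (lcst * prox (N - i) ^+ 2 / j i) =
     lcst * m%:R / j i / j k * (prox (N - i) * prox (N - i)) by ring.
  have -> : lcst * m%:R * (prox (N - i) / j i * (prox (N - k) / j k)) =
     lcst * m%:R / j i / j k * (prox (N - i) * prox (N - k)) by ring.
  by rewrite ler_wpM2l ?ler_wpM2l// !mulr_ge0 ?invr_ge0 ?ler0n// ltW.
have pair i k : (i < N)%N -> (k < N)%N -> E (fun w => a i w * a k w) <= lcst * m%:R * (b i * b k).
  move=> iN kN; have [h|h] := leP (prox (N - i)) (prox (N - k)); first exact: half.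
  have := half k i kN iN (ltW h); rewrite [b k * _]mulrC.
  by under eq_deck_exp do rewrite mulrC.
apply: (@le_trans _ _ (\sum_(i < N) \sum_(k < N) lcst * m%:R * (b i * b k))).
  have -> : E (fun w => (\sum_(i < N) `|p i w - q (N - i.+1)%N|) ^+ 2) =
     \sum_(i < N) \sum_(k < N) E (fun w => a i w * a k w).
    under [RHS]eq_bigr do rewrite -deck_exp_sum.
    rewrite -deck_exp_sum; apply: eq_deck_exp => w.
    rewrite expr2 mulr_suml; apply: eq_bigr => i _.
    by rewrite mulr_sumr.
  by apply: ler_sum => i _; apply: ler_sum => k _; exact: pair.
have -> : \sum_(i < N) \sum_(k < N) lcst * m%:R * (b i * b k) =
   lcst * m%:R * (\sum_(i < N) b i) ^+ 2.
  rewrite expr2 mulr_suml mulr_sumr; apply: eq_bigr => i _.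
  by rewrite !mulr_sumr.
rewrite ler_wpM2l ?mulr_ge0 ?ler0n// (sum_ord_rev (fun k => prox k.+1 / k.+1%:R)).
have s0 : 0 <= \sum_(k < N) prox k.+1 / k.+1%:R.
  by apply: sumr_ge0 => k _; rewrite divr_ge0// proximity_ge0.
by rewrite ler_sqr ?nnegrE ?sum_proximity// mulr_ge0 ?ler0n.
Qed.

(** For j >= 2 m the parameter lies between 1 / j and 1 / 2, so its variance is at least 1 / (2
    j). *)
Lemma bern_var_ge k : 2 * m%:R <= k.+1%:R :> R ->
  (ln k.+1%:R - ln (2 * m%:R) - 1) / 2 <= bern_var q k.
Proof.
move=> mk; have t1 : 1 <= 2 * m%:R :> R by have := m1'; lra.
apply: (@le_trans _ _ (harm_tail (2 * m%:R) k / 2)).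
  by rewrite ler_wpM2r// harm_tail_ge.
rewrite /harm_tail mulr_suml; apply: ler_sum => i _.
have /andP[qi0 qi1] := q01 i.
have [mi|_] := leP (2 * m%:R) i.+1%:R; last by rewrite !mul0r mulr_ge0// subr_ge0.
have i0 : 0 < i.+1%:R :> R by rewrite ltr0n.
have q1 : i.+1%:R^-1 <= q i by rewrite /level_prob -[leLHS]mul1r ler_wpM2r ?invr_ge0// level_ge1.
have q2 : q i <= 2^-1.
  rewrite /level_prob ler_pdivrMr//; have := level_le_m R m n i.+1.
  by move: mi; move: (level _ _ _ _) (i.+1%:R : R) => u v; lra.
rewrite mul1r; apply: ler_pM => //.
by move: q2; move: (q i) => u; lra.
Qed.

(** Bound for the point probabilities of the remaining Bernoulli sum, trivial up to n^(1/4)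
    cards. *)
Let kappa k : R := if k.+1%:R <= expR (l / 4) then 1 else 4 / Num.sqrt l.

Let kappa_point k s (a : nat) : bern_exp q k (fun i => (i == a)%:R) s <= kappa k.
Proof.
rewrite /kappa; case: ifPn => [_|].
  rewrite -[leRHS](bern_exp_cst q k 1 s); apply: bern_exp_le => // i.
  by case: (i == a).
rewrite -ltNge => hk.
have k0 : 0 < k.+1%:R :> R by rewrite ltr0n.
have lk : l / 4 < ln k.+1%:R by rewrite -[ltLHS]expRK ltr_ln ?posrE ?expR_gt0.
have ln2 : 0 <= ln (2 * m%:R) :> R by rewrite ln_ge0//; have := m1'; lra.
have hb := n_large.
have mk : 2 * m%:R <= k.+1%:R :> R.
  by rewrite -ler_ln ?posrE ?mulr_gt0//; lra.
have -> : 4 / Num.sqrt l = (Num.sqrt l / 4)^-1 by rewrite invf_div.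
apply: bern_point_le => //; first by rewrite divr_gt0.
(* The lower bound is at least (l / 4 - l / 8) / 2 = l / 16, the square of sqrt(l) / 4. *)
apply: le_trans (bern_var_ge mk).
rewrite expr_div_n sqlE.
by move: lk hb; move: (ln k.+1%:R) (ln (2 * m%:R)) (ln n%:R) => u v x; lra.
Qed.

(** Where [kappa] is trivial, the proximity is at most m exp(- l / 4), and exp(l / 4) exceeds
    sqrt(l) / 4. *)
Let kappa_prox k : prox k.+1 * kappa k <= 4 * m%:R / Num.sqrt l.
Proof.
have -> : 4 * m%:R / Num.sqrt l = m%:R * (4 / Num.sqrt l) by ring.
rewrite /kappa; case: ifPn => [h|_].
  rewrite mulr1 (le_trans (proximity_low m1 n_large (ltn0Sn k) h))// ler_wpM2l ?(ltW m0)//.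
  have -> : 4 / Num.sqrt l = (Num.sqrt l / 4)^-1 by rewrite invf_div.
  rewrite expRN lef_pV2 ?posrE ?expR_gt0 ?divr_gt0//.
  apply: le_trans (expR_ge1Dx _).
  have : Num.sqrt l <= l.
    rewrite -[leRHS]sqlE -[leLHS]mulr1 expr2 ler_wpM2l ?(ltW sql0)//.
    by rewrite -[leLHS]sqrtr1 ler_wsqrtr//; have := l8; lra.
  by move: (Num.sqrt _) => u; move: (ln n%:R) => v; lra.
rewrite ler_wpM2r ?divr_ge0 ?(ltW sql0)//.
exact: proximity_le_m.
Qed.

(** The indicator of an initial segment jumps at most once, so one more hit changes its expectation
    by at most one point probability. *)
Lemma hits_bern_compare (g : strategy m n) (P : pred nat) : greedy g ->
  (forall i, P i.+1 -> P i) ->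
  `|E (fun w => (P (hits g N w))%:R) - bern_exp q N (fun i => (P i)%:R) 0|
  <= lcst * (4 * m%:R / Num.sqrt l) * (3 * m%:R).
Proof.
move=> gP Pdown; pose f i : R := (P i)%:R.
have kappa0 k : 0 <= kappa k.
  by rewrite /kappa; case: ifP => // _; rewrite divr_ge0// ltW.
apply: le_trans (hits_bern_le gP (f := f) (q := q) (kappa := kappa) _)
  (sum_hit_prob_dev kappa0 kappa_prox) => k s.
rewrite bern_expS -bern_expB.
have down i j : (i <= j)%N -> P j -> P i.
  move=> ij; elim: j ij => [|j IH]; first by rewrite leqn0 => /eqP ->.
  by rewrite leq_eqVlt => /predU1P[->//|/IH h /Pdown].
have [[a /andP[Pa nPa]]|none] := pselect (exists a, P a && ~~ P a.+1).
  apply: le_trans (kappa_point k s a); apply: le_trans (bern_exp_norm _ _ _ _) _ => //.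
  apply: bern_exp_le => // i; rewrite /f.
  have [->|ia] := eqVneq i a; first by rewrite Pa (negbTE nPa) sub0r normrN normr1.
  have [lt|gt] : (i < a)%N \/ (a < i)%N by apply/orP; rewrite -neq_ltn.
    by rewrite (down _ _ lt Pa) (down _ _ (ltnW lt) Pa) subrr normr0.
  have nPi : ~~ P i by apply: contra nPa; exact: down.
  by rewrite (negbTE nPi) (negbTE (contra (@Pdown i) nPi)) subrr normr0.
rewrite (_ : (fun i => f i.+1 - f i) = fun=> 0).
  by rewrite bern_exp_cst normr0.
apply/funext => i; rewrite /f; have [Pi|nPi] := boolP (P i).
  have -> : P i.+1 by apply/negPn/negP => h; apply: none; exists i; rewrite Pi h.
  by rewrite subrr.
by rewrite (negbTE (contra (@Pdown i) nPi)) subrr.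
Qed.

(** * Mean and variance up to controlled errors *)

Definition harmonic_cst : R := \sum_(1 <= r < m.+1) r%:R^-1.

Definition mean_err : R := m%:R * (1 + ln m%:R).

(** After exchanging sums, threshold r contributes the harmonic sum from n^(1 - 1/r) to m n, which
    is ln m + (ln n) / r up to 1. *)
Lemma bern_mean_level : `|bern_mean q N - harmonic_cst * l| <= mean_err.
Proof.
have n0 : 0 < n%:R :> R by rewrite ltr0n (level_n0 m1 n_large).
have -> : bern_mean q N = \sum_(1 <= r < m.+1) harm_tail (threshold R n r) N.
  rewrite /bern_mean /harm_tail exchange_big /=; apply: eq_bigr => i _.
  by rewrite /level_prob mulr_suml.
rewrite /harmonic_cst mulr_suml -sumrB; apply: le_trans (ler_norm_sum _ _ _) _.
have -> : mean_err = \sum_(1 <= r < m.+1) (1 + ln m%:R).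
  by rewrite sumr_const_nat subn1 /mean_err mulr_natl.
rewrite big_nat_cond [leRHS]big_nat_cond; apply: ler_sum => r /andP[/andP[r1 _] _].
have t0 := threshold_gt0 R n r; have tN := threshold_leN m1 n_large r.
have N0 : 0 < N%:R :> R by rewrite (lt_le_trans t0).
have up := harm_tail_le t0 tN.
have lo : ln N%:R - ln (threshold R n r) - 1 <= harm_tail (threshold R n r) N.
  have tN1 : threshold R n r <= N.+1%:R by rewrite (le_trans tN)// ler_nat.
  apply: le_trans (harm_tail_ge (threshold_ge1 m1 n_large r1) tN1).
  have N1 : 0 < N.+1%:R :> R by rewrite ltr0Sn.
  by rewrite 2!lerD2r ler_ln ?posrE// ler_nat.
have lnN : ln N%:R = ln m%:R + l by rewrite natrM lnM ?posrE.
have lnm : 0 <= ln m%:R :> R by rewrite ln_ge0.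
rewrite ln_threshold lnN in up lo.
have e : ln m%:R + l - l * (1 - r%:R^-1) = ln m%:R + r%:R^-1 * l by ring.
by rewrite e in up lo; rewrite ler_norml; move: up lo lnm;
  move: (harm_tail _ _) (r%:R^-1 * l) (ln m%:R) => u v x; lra.
Qed.

Lemma bern_var_level : `|bern_var q N - bern_mean q N| <= 2 * m%:R ^+ 2.
Proof.
have -> : bern_var q N - bern_mean q N = - \sum_(i < N) q i ^+ 2.
  by rewrite /bern_var /bern_mean -sumrB -sumrN; apply: eq_bigr => i _; ring.
rewrite normrN ger0_norm ?sumr_ge0// => [|i _]; last exact: sqr_ge0.
apply: (@le_trans _ _ (\sum_(i < N) m%:R ^+ 2 * (i.+1%:R^-1) ^+ 2)).
  apply: ler_sum => i _; rewrite /level_prob exprMn ler_wpM2r ?sqr_ge0//.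
  rewrite ler_sqr ?nnegrE ?level_le_m ?ler0n//.
  by apply: sumr_ge0.
by rewrite -mulr_sumr mulrC ler_wpM2r ?sqr_ge0// sum_inv_sq_le.
Qed.

Section Moments.
Variable g : strategy m n.
Hypothesis gP : greedy g.

Let mu : R := E (fun w => (hits g N w)%:R).
Let v : R := \sum_(k < N) E (fun w => p k w * (1 - p k w)).

Lemma hits_mean_level : `|mu - bern_mean q N| <= lcst * m%:R * (3 * m%:R).
Proof.
rewrite /mu hits_mean// /bern_mean -(sum_ord_rev q) -sumrB.
apply: le_trans (ler_norm_sum _ _ _) (le_trans _ sum_hit_prob_dev1).
apply: ler_sum => i _; rewrite -[X in _ - X](deck_exp_cst m n) -deck_expB.
exact: deck_exp_norm.
Qed.

Lemma cond_var_level : `|v - bern_var q N| <= lcst * m%:R * (3 * m%:R).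
Proof.
rewrite /v /bern_var -(sum_ord_rev (fun i => q i * (1 - q i))) -sumrB.
apply: le_trans (ler_norm_sum _ _ _) (le_trans _ sum_hit_prob_dev1).
apply: ler_sum => i _; rewrite -[X in _ - X](deck_exp_cst m n) -deck_expB.
apply: le_trans (deck_exp_norm _) _; apply: deck_exp_le => w.
have /andP[p0 p1] := hit_prob01 R i w; have /andP[q0 q1] := q01 (N - i.+1)%N.
set x := p i w in p0 p1 *; set y := q (N - i.+1)%N in q0 q1 *.
have -> : x * (1 - x) - y * (1 - y) = (x - y) * (1 - x - y) by ring.
by rewrite normrM ler_piMr// ler_norml; lra.
Qed.

(** The choice d = 1 / sqrt(l) balances d v, with v of order l, against 1 / d times a bounded second
    moment. *)
Lemma hits_variance_level :
  `|E (fun w => ((hits g N w)%:R - mu) ^+ 2) - v| <=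
  (Num.sqrt l)^-1 * v + (1 + Num.sqrt l) * (lcst * m%:R * (3 * m%:R) ^+ 2).
Proof.
have d0 : 0 < (Num.sqrt l)^-1 by rewrite invr_gt0.
apply: le_trans (hits_variance gP q d0) _; rewrite invrK lerD2l.
by rewrite ler_wpM2l ?sum_hit_prob_dev_sq// addr_ge0// ltW.
Qed.

End Moments.
End Estimates.

(** * Asymptotics and the normal approximation *)

Section Asymptotics.
Variable R : realType.

Lemma ln3_gt1 : 1 < ln 3 :> R.
Proof.
suff h : expR 1 < 3 :> R.
  by rewrite -[ltLHS]expRK ltr_ln ?posrE ?expR_gt0.
(* From exp(-1/6) >= 5/6; and (6/5)^6 = 2.985984 < 3. *)
have e6 : expR (6^-1) <= 6 / 5 :> R.
  have := expR_ge1Dx (- 6^-1 : R); rewrite expRN.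
  have e0 : 0 < expR 6^-1 :> R by exact: expR_gt0.
  rewrite -[leRHS]mul1r ler_pdivlMr//.
  by move: (expR _) => x; lra.
have -> : 1 = 6%:R * 6^-1 :> R by field.
rewrite expRM_natl; apply: (@le_lt_trans _ _ ((6 / 5) ^+ 6)).
  by rewrite lerXn2r ?nnegrE ?expR_ge0.
lra.
Qed.

Lemma cvg1_of_ln_bound (a : nat -> R) (K l0 : R) : 0 <= K ->
  (forall n : nat, l0 <= ln n%:R -> `|a n - 1| <= K / Num.sqrt (ln n%:R)) ->
  a n @[n --> \oo] --> (1 : R).
Proof.
move=> K0 h; apply/cvgrPdist_le => e e0.
pose b := Num.max (Num.max l0 1) ((K / e) ^+ 2).
near=> n.
have bn : b <= ln n%:R.
  have en : expR b <= n%:R by near: n; exact: nbhs_infty_ger.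
  have n0 : 0 < n%:R :> R by rewrite (lt_le_trans _ en)// expR_gt0.
  by rewrite -[leLHS]expRK ler_ln ?posrE// expR_gt0.
move: bn; rewrite /b !ge_max => /andP[/andP[l0n l1n] Kn].
have s0 : 0 < Num.sqrt (ln n%:R : R) by rewrite sqrtr_gt0 (lt_le_trans _ l1n).
rewrite distrC; apply: (le_trans (h n l0n)).
rewrite ler_pdivrMr// mulrC -ler_pdivrMr//.
rewrite -[leLHS](@ger0_norm _ (K / e)); last by rewrite divr_ge0// ltW.
by rewrite -sqrtr_sqr ler_wsqrtr.
Unshelve. all: by end_near. Qed.

Variable m : nat.
Hypothesis m1 : (1 <= m)%N.
Local Notation H := (harmonic_cst R m).

Let m1' : 1 <= m%:R :> R. Proof. by rewrite ler1n. Qed.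
Let c1 : 1 <= level_cst R m. Proof. exact: level_cst_ge1. Qed.

Lemma harmonic_cst_ge1 : 1 <= H.
Proof.
by rewrite /harmonic_cst big_ltn ?ltnS// invr1 lerDl sumr_ge0.
Qed.

(** One constant for all errors: those of the hit probabilities ([K1]), of the harmonic sums ([K2]),
    of the squared parameters ([K3]) and of the second moment ([Q]); H enters through v /
    sqrt(l). *)
Definition err_cst : R :=
  3 * (level_cst R m * m%:R * (3 * m%:R) + mean_err R m + 2 * m%:R ^+ 2)
  + H + 2 * (level_cst R m * m%:R * (3 * m%:R) ^+ 2).

Let A := err_cst.

Let K1 := level_cst R m * m%:R * (3 * m%:R).
Let K2 := mean_err R m.
Let K3 : R := 2 * m%:R ^+ 2.
Let Q := level_cst R m * m%:R * (3 * m%:R) ^+ 2.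

Let AE : A = 3 * (K1 + K2 + K3) + H + 2 * Q. Proof. by []. Qed.
Let K1_ge0 : 0 <= K1.
Proof. by rewrite !mulr_ge0// (le_trans ler01). Qed.
Let K2_ge0 : 0 <= K2.
Proof. by rewrite mulr_ge0// addr_ge0// ln_ge0. Qed.
Let K3_ge0 : 0 <= K3.
Proof. by rewrite mulr_ge0// sqr_ge0. Qed.
Let Q_ge0 : 0 <= Q.
Proof. by rewrite !mulr_ge0 ?exprn_ge0 ?mulr_ge0// (le_trans ler01). Qed.

Lemma err_cst_ge1 : 1 <= A.
Proof.
rewrite AE; move: K1_ge0 K2_ge0 K3_ge0 Q_ge0 harmonic_cst_ge1.
by move: K1 K2 K3 Q H => a b c d e; lra.
Qed.

(** * Bounds for a fixed large n *)

Section Estimates.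
Variables (n : nat) (g : strategy m n).
Hypothesis gP : greedy g.
Local Notation N := (m * n)%N.
Local Notation l := (ln n%:R : R).
Hypothesis n_large : 8 * (ln (2 * m%:R) + 1) <= l.
Local Notation q := (level_prob R m n).
Local Notation sq := (Num.sqrt l).
Local Notation mu := (mean_score R g).
Local Notation s2 := (var_score R g).

Let sc w : scoreR R g w = (hits g N w)%:R.
Proof. by rewrite /scoreR score_hits. Qed.

Let muE : mu = deck_exp (fun w => (hits g N w)%:R).
Proof. by rewrite mean_scoreE; apply: eq_deck_exp. Qed.

Let l8 : 8 <= l. Proof. exact: level_l8 n_large. Qed.
Let sqE : sq ^+ 2 = l. Proof. by rewrite sqr_sqrtr//; have := l8; lra. Qed.
Let sq1 : 1 <= sq.
Proof. by rewrite -[leLHS]sqrtr1 ler_wsqrtr//; have := l8; lra. Qed.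

(** Here the error must stay bounded: after division by the standard deviation it enters the normal
    approximation. *)
Lemma mean_score_bern : `|mu - bern_mean q N| <= A.
Proof.
rewrite muE; apply: le_trans (hits_mean_level m1 n_large gP) _.
rewrite -/K1 AE; move: K1_ge0 K2_ge0 K3_ge0 Q_ge0 harmonic_cst_ge1.
by move: K1 K2 K3 Q H => a b c d e; lra.
Qed.

Lemma mean_score_asymp : `|mu - H * l| <= A * sq.
Proof.
have h1 := hits_mean_level m1 n_large gP; have h2 := bern_mean_level m1 n_large.
rewrite -muE -/K1 in h1; rewrite -/K2 in h2.
apply: (@le_trans _ _ A); last by rewrite ler_peMr// (le_trans ler01 err_cst_ge1).
have -> : mu - H * l = (mu - bern_mean q N) + (bern_mean q N - H * l) by ring.
apply: le_trans (ler_normD _ _) _; apply: (le_trans (lerD h1 h2)).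
rewrite AE; move: K1_ge0 K2_ge0 K3_ge0 Q_ge0 harmonic_cst_ge1.
by move: K1 K2 K3 Q H => a b c d e; lra.
Qed.

Lemma bern_var_asymp : `|bern_var q N - H * l| <= A.
Proof.
have h1 := bern_var_level R m n; have h2 := bern_mean_level m1 n_large.
rewrite -/K3 in h1; rewrite -/K2 in h2.
have -> : bern_var q N - H * l = (bern_var q N - bern_mean q N) + (bern_mean q N - H * l) by ring.
apply: le_trans (ler_normD _ _) _; apply: (le_trans (lerD h1 h2)).
rewrite AE; move: K1_ge0 K2_ge0 K3_ge0 Q_ge0 harmonic_cst_ge1.
by move: K1 K2 K3 Q H => a b c d e; lra.
Qed.

Lemma var_score_asymp : `|s2 - H * l| <= A * sq.
Proof.
have sq0 : 0 < sq by exact: lt_le_trans ltr01 sq1.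
have h1 := bern_var_level R m n; have h2 := bern_mean_level m1 n_large.
have h3 := cond_var_level m1 n_large; have h4 := hits_variance_level m1 n_large gP.
rewrite -/K3 in h1; rewrite -/K2 in h2; rewrite -/K1 in h3; rewrite -/Q in h4.
set v := \sum_(k < N) _ in h3 h4.
have s2E : s2 = deck_exp (fun w => ((hits g N w)%:R - deck_exp (fun w => (hits g N w)%:R)) ^+ 2).
  by rewrite var_scoreE; apply: eq_deck_exp => w; rewrite sc -muE.
rewrite -s2E in h4.
set L := H * l in h2 *.
have h5 : `|v - L| <= K1 + K2 + K3.
  have -> : v - L = (v - bern_var q N) + (bern_var q N - bern_mean q N)
     + (bern_mean q N - L) by ring.
  apply: le_trans (ler_normD _ _) _; rewrite [leRHS]addrAC lerD//.
  by apply: le_trans (ler_normD _ _) _; rewrite lerD.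
have h6 : sq^-1 * v <= H * sq + (K1 + K2 + K3).
  have vle : v <= L + (K1 + K2 + K3) by move: h5; rewrite ler_norml; lra.
  have -> : H * sq = sq^-1 * L.
    have e : H * sq = sq^-1 * (H * (sq * sq)).
      by move: sq0; move: sq => y y0; field; rewrite gt_eqF.
    by rewrite e -expr2 sqE.
  apply: (@le_trans _ _ (sq^-1 * (L + (K1 + K2 + K3)))).
    by rewrite ler_wpM2l// invr_ge0 ltW.
  rewrite mulrDr lerD2l ler_piMl ?invf_le1//.
  by rewrite !addr_ge0.
have -> : s2 - L = (s2 - v) + (v - L) by ring.
apply: le_trans (ler_normD _ _) _; apply: (le_trans (lerD h4 h5)).
rewrite AE; move: K1_ge0 K2_ge0 K3_ge0 Q_ge0 harmonic_cst_ge1 sq1 h6.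
move: K1 K2 K3 Q H sq (sq^-1 * v) => a b c d e x y a0 b0 c0 d0 e0 x1 h6.
have : a <= a * x by rewrite ler_peMr.
have : b <= b * x by rewrite ler_peMr.
have : c <= c * x by rewrite ler_peMr.
have : d <= d * x by rewrite ler_peMr.
by lra.
Qed.

Hypothesis n_large2 : 2 * A <= sq.

(** As H >= 1 and A sqrt(l) <= l / 2, the error removes at most half of l. *)
Lemma var_score_ge : l / 2 <= s2.
Proof.
have h := var_score_asymp; have A1 := err_cst_ge1; have H1 := harmonic_cst_ge1.
have l0 := l8.
have Asq : A * sq <= l / 2.
  have -> : l / 2 = sq / 2 * sq by rewrite mulrAC -expr2 sqE.
  rewrite ler_wpM2r ?(le_trans ler01 sq1)//.
  by have := n_large2; lra.
have Hl : l <= H * l by rewrite ler_peMl//; lra.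
by move: h; rewrite ler_norml; lra.
Qed.

Lemma ratio_bound (x : R) : `|x - s2| <= 2 * A * sq -> `|x / s2 - 1| <= 4 * A / sq.
Proof.
move=> h; have sge := var_score_ge; have l0 := l8.
have s0 : 0 < s2 by lra.
have sq0 : 0 < sq by exact: lt_le_trans ltr01 sq1.
have -> : x / s2 - 1 = (x - s2) / s2 by field; rewrite gt_eqF.
rewrite normrM [X in _ * X]ger0_norm ?invr_ge0 ?(ltW s0)// ler_pdivrMr//.
apply: (le_trans h); apply: (@le_trans _ _ (4 * A / sq * (l / 2))).
  have e : 2 * A * sq = 4 * A / sq * ((sq * sq) / 2).
    by move: sq0; move: sq => y y0; field; rewrite gt_eqF.
  by rewrite e -expr2 sqE.
by rewrite ler_wpM2l// divr_ge0 ?(ltW sq0)//; have := err_cst_ge1; lra.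
Qed.

Lemma mean_var_ratio : `|mu / s2 - 1| <= 4 * A / sq.
Proof.
apply: ratio_bound; have -> : mu - s2 = (mu - H * l) - (s2 - H * l) by ring.
by apply: le_trans (ler_normB _ _) _; move: mean_score_asymp var_score_asymp; lra.
Qed.

Lemma var_ln_ratio : `|s2 / (H * l) - 1| <= 4 * A / sq.
Proof.
have l0 := l8; have H1 := harmonic_cst_ge1; have A1 := err_cst_ge1.
have sq0 : 0 < sq by exact: lt_le_trans ltr01 sq1.
have Hl : l <= H * l by rewrite ler_peMl//; lra.
have Hl0 : 0 < H * l by lra.
have -> : s2 / (H * l) - 1 = (s2 - H * l) / (H * l).
  by move: Hl0; move: (H * l) => x x0; field; rewrite gt_eqF.
rewrite normrM [X in _ * X]ger0_norm ?invr_ge0 ?(ltW Hl0)// ler_pdivrMr//.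
apply: (le_trans var_score_asymp); apply: (@le_trans _ _ (4 * A / sq * l)).
  have -> : 4 * A / sq * l = 4 * A * sq.
    by rewrite -[X in _ * X]sqE; move: sq0; move: sq => y y0; field; rewrite gt_eqF.
  by rewrite ler_wpM2r ?(ltW sq0)//; lra.
by rewrite ler_wpM2l// divr_ge0 ?(ltW sq0)//; lra.
Qed.

Definition berry_esseen_cst : R :=
  12 * level_cst R m * m%:R ^+ 2 + 8 * A + 2 * A * stein_bound R + 2 * (12 * stein_bound R + 48).

(** The terms of [berry_esseen_cst] are, in order, the costs of trading the hits, of the variance
    mismatch, of the mean mismatch and of the Stein remainder; 1 / sg is at most 2 / sqrt(l). *)
Lemma std_score_berry_esseen (x : R) :
  `|deck_exp (fun w => ((scoreR R g w - mu) / std_score R g <= x)%R%:R) - Phi x|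
  <= berry_esseen_cst / sq.
Proof.
have l0 := l8; have A1 := err_cst_ge1; have H1 := harmonic_cst_ge1.
have sq0 : 0 < sq by exact: lt_le_trans ltr01 sq1.
have sge := var_score_ge; have s0 : 0 < s2 by lra.
set sg := std_score R g.
have sgE : sg ^+ 2 = s2 by rewrite /sg /std_score sqr_sqrtr// ltW.
have sg_ge : sq / 2 <= sg.
  have q2 : 0 <= sq / 2 by rewrite divr_ge0// ltW.
  rewrite -(ger0_norm q2) -sqrtr_sqr /sg /std_score ler_wsqrtr//.
  by rewrite expr_div_n sqE; lra.
have sgA : A <= sg by have := n_large2; lra.
have sg1 : 1 <= sg by exact: le_trans sgA.
have sg0 : 0 < sg by lra.
pose P (i : nat) := (i%:R - mu) / sg <= x.
have Pdown i : P i.+1 -> P i.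
  rewrite /P; apply: le_trans; rewrite ler_wpM2r ?invr_ge0 ?(ltW sg0)// lerD2r.
  by rewrite ler_nat.
have cmp := hits_bern_compare m1 n_large gP Pdown.
have hb := bern_var_asymp; have hs := var_score_asymp; have hm := mean_score_bern.
have Asq : A * sq <= l / 2.
  have -> : l / 2 = sq / 2 * sq by rewrite mulrAC -expr2 sqE.
  rewrite ler_wpM2r ?(ltW sq0)//.
  by have := n_large2; lra.
have Hl : l <= H * l by rewrite ler_peMl//; lra.
have AAsq : A <= A * sq by rewrite ler_peMr//; lra.
have bv4 : bern_var q N <= 4 * sg ^+ 2.
  by move: hb hs; rewrite sgE !ler_norml; lra.
have b1 : `|(bern_mean q N - mu) / sg| <= A / sg.
  by rewrite normrM [X in _ * X]ger0_norm ?invr_ge0 ?(ltW sg0)//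
       ler_wpM2r ?invr_ge0 ?(ltW sg0)// distrC.
have b2 : A / sg <= 2 * A / sq.
  rewrite ler_pdivrMr// mulrAC ler_pdivlMr//.
  have -> : 2 * A * sg = A * (2 * sg) by ring.
  by rewrite ler_wpM2l//; lra.
have b3 : `|(bern_mean q N - mu) / sg| <= 1.
  by apply: (le_trans b1); rewrite ler_pdivrMr// mul1r.
have bs := bern_stein (level_prob01 m1 n_large) (mu := mu) x sg1 bv4 b3.
have r1 : `|1 - bern_var q N / sg ^+ 2| <= 4 * A / sq.
  rewrite distrC sgE; apply: ratio_bound.
  have -> : bern_var q N - s2 = (bern_var q N - H * l) - (s2 - H * l) by ring.
  by apply: le_trans (ler_normB _ _) _; lra.
have -> : deck_exp (fun w => ((scoreR R g w - mu) / sg <= x)%R%:R) - Phi x =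
   (deck_exp (fun w => (P (hits g N w))%:R) - bern_exp q N (fun i => (P i)%:R) 0)
   + (bern_exp q N (fun i => (P i)%:R) 0 - Phi x).
  rewrite addrA subrK; congr (_ - _); apply: eq_deck_exp => w.
  by rewrite /P sc.
apply: le_trans (ler_normD _ _) _; apply: (le_trans (lerD cmp bs)).
have C1 := stein_bound_ge1 R; set C := stein_bound R in C1 *.
have t1 : C * `|(bern_mean q N - mu) / sg| <= C * (2 * A / sq).
  by rewrite ler_wpM2l ?(le_trans b1)//; lra.
have t2 : (12 * C + 48) / sg <= (12 * C + 48) * (2 / sq).
  rewrite ler_wpM2l//; first by lra.
  by rewrite -[2]invrK -invfM lef_pV2 ?posrE ?mulr_gt0 ?invr_gt0// mulrC.
have -> : berry_esseen_cst / sq = level_cst R m * (4 * m%:R / sq) * (3 * m%:R)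
   + (2 * (4 * A / sq) + C * (2 * A / sq) + (12 * C + 48) * (2 / sq)).
  by rewrite /berry_esseen_cst -/C; ring.
by rewrite lerD2l !lerD// ler_wpM2l.
Qed.

End Estimates.

Definition ln_large : R := Num.max (8 * (ln (2 * m%:R) + 1)) ((2 * A) ^+ 2).

Lemma ln_largeP (l : R) : ln_large <= l ->
  8 * (ln (2 * m%:R) + 1) <= l /\ 2 * A <= Num.sqrt l.
Proof.
rewrite /ln_large ge_max => /andP[h1 h2]; split => //.
have A2 : 0 <= 2 * A by have := err_cst_ge1; lra.
by rewrite -(ger0_norm A2) -sqrtr_sqr ler_wsqrtr.
Qed.

Lemma score_cdf_dist_le1 (n : nat) (g : strategy m n) (x : R) :
  `|deck_exp (fun w => ((scoreR R g w - mean_score R g) / std_score R g <= x)%R%:R) - Phi x| <= 1.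
Proof.
set e := deck_exp _.
have e0 : 0 <= e.
  by rewrite -(deck_exp_cst m n (0 : R)); apply: deck_exp_le => w.
have e1 : e <= 1.
  by rewrite -(deck_exp_cst m n (1 : R)); apply: deck_exp_le => w; case: (_ / _ <= _).
by have := Phi_ge0 x; have := Phi_le1 x; rewrite ler_norml; lra.
Qed.

End Asymptotics.

Theorem theorem1p1 (R : realType) (m : nat) (hm : (1 <= m)%N) :
  (forall g : (forall n : nat, strategy m n), (forall n, greedy (g n)) ->
     asymp_equiv (fun n => mean_score R (g n)) (fun n => var_score R (g n)) /\
     asymp_equiv (fun n => var_score R (g n))
       (fun n => (\sum_(1 <= k < m.+1) k%:R^-1) * ln n%:R)) /\
  (exists C : R, forall n : nat, (3 <= n)%N ->
     forall g : strategy m n, greedy g ->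
       (ereal_sup [set `| std_score_cdf g x - std_normal_cdf x | | x in [set: R]]
        <= (C * (ln (ln n%:R) / Num.sqrt (ln n%:R)))%:E)%E).
Proof.
have K0 : 0 <= 4 * err_cst R m by have := err_cst_ge1 R hm; lra.
split.
  move=> g gP; split;
    apply: (@cvg1_of_ln_bound R _ (4 * err_cst R m) (ln_large R m)) => // n
      /(ln_largeP hm)[b1 b2].
  - exact: mean_var_ratio.
  - exact: var_ln_ratio.
(* The entry sqrt(L) of [B] serves those n with ln n below [ln_large], where the distance is bounded
   by 1. *)
pose L := Num.max (ln_large R m) 1; pose B := Num.max (berry_esseen_cst R m) (Num.sqrt L).
have lnln3 : 0 < ln (ln 3) :> R by rewrite ln_gt0// ln3_gt1.
(* Since 3 > e, ln ln 3 is positive, and ln ln n >= ln ln 3 turns the bound B / sqrt(ln n) into the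
   required form. *)
exists (B / ln (ln 3)) => n n3 g gP.
have l3 : ln 3 <= ln n%:R :> R by rewrite ler_ln ?posrE ?ltr0n ?ler_nat// (leq_trans _ n3).
have l1 : 1 < ln n%:R :> R by exact: lt_le_trans (ln3_gt1 R) l3.
have ll : ln (ln 3) <= ln (ln n%:R) :> R.
  by rewrite ler_ln ?posrE// ?(lt_trans ltr01 l1)// (lt_trans ltr01 (ln3_gt1 R)).
have sq0 : 0 < Num.sqrt (ln n%:R : R) by rewrite sqrtr_gt0 (lt_trans ltr01).
have B0 : 0 <= B by rewrite le_max sqrtr_ge0 orbT.
have BC : B / Num.sqrt (ln n%:R) <= B / ln (ln 3) * (ln (ln n%:R) / Num.sqrt (ln n%:R)).
  rewrite mulrA ler_wpM2r ?invr_ge0 ?(ltW sq0)// mulrAC -mulrA ler_peMr//.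
  by rewrite ler_pdivlMr// mul1r.
apply: ge_ereal_sup => _ [x _ <-].
rewrite std_score_cdfE std_normal_cdfE -EFinB /= lee_fin; apply: le_trans BC.
rewrite ler_pdivlMr//.
have [h|h] := leP (ln_large R m) (ln n%:R).
  have [b1 b2] := ln_largeP hm h.
  rewrite -ler_pdivlMr//; apply: (le_trans (std_score_berry_esseen hm gP b1 b2 x)).
  by rewrite ler_wpM2r ?invr_ge0 ?(ltW sq0)// le_max lexx.
apply: (@le_trans _ _ (1 * Num.sqrt (ln n%:R))).
  by rewrite ler_wpM2r ?(ltW sq0)// score_cdf_dist_le1.
by rewrite mul1r le_max; apply/orP; right; rewrite ler_wsqrtr// le_max ltW.
Qed.
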